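(* Let $K$ be a field of characteristic zero, $n\ge 1$, $L_n=K[x_1^{\pm1},\ldots,x_n^{\pm1}]$ the Laurent polynomial algebra, and $W_n=\mathrm{Der}_K(L_n)=\bigoplus_{i=1}^n L_n\partial_i$ the Witt Lie algebra (with $\partial_i=\partial/\partial x_i$ and bracket $[\partial,\delta]=\partial\delta-\delta\partial$). Then the group homomorphism $\mathrm{Aut}_{K\text{-alg}}(L_n)\to \mathrm{Aut}_{\mathrm{Lie}}(W_n)$, $\sigma\mapsto(\partial\mapsto\sigma\partial\sigma^{-1})$, is an isomorphism. Consequently $\mathrm{Aut}_{\mathrm{Lie}}(W_n)\simeq \mathrm{Aut}_{K\text{-alg}}(L_n)\simeq \mathrm{GL}_n(\mathbb{Z})\ltimes K^{*n}$.
   Context: $K^*$ denotes the group of units of $K$. $\mathrm{GL}_n(\mathbb{Z})$ embeds in $\mathrm{Aut}_{K\text{-alg}}(L_n)$ via $A=(a_{ij})\mapsto\sigma_A$, $\sigma_A(x_i)=\prod_{j=1}^n x_j^{a_{ji}}$, and $K^{*n}$ is identified with the torus of automorphisms $t_\lambda$, $t_\lambda(x_i)=\lambda_ix_i$, $\lambda\in K^{*n}$. *)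

(* Defs.v *)
From HB Require Import structures.
From mathcomp Require Import all_boot all_order all_algebra.
From mathcomp Require Import finmap.
From mathcomp.multinomials Require Import monalg.

Set Implicit Arguments.
Unset Strict Implicit.
Unset Printing Implicit Defensive.

Import GRing.Theory.
Local Open Scope fset.
Local Open Scope ring_scope.

(* Laurent polynomial algebra L_n = K[x_1^{+-1},...,x_n^{+-1}], built  *)
(* as the group algebra K[Z^n]: finitely supported functions           *)
(* Z^n -> K (exponent vectors are row vectors 'rV[int]_n), with the    *)
(* convolution product.  The element with coefficient c at exponent k  *)
(* is << c *g k >> = c x^k.                                            *)

Definition expo (n : nat) := 'rV[int]_n.

Definition laurent (R : comRingType) (n : nat) : predArgType :=
  malg (expo n) R.

Section LaurentRing.
Context (R : comRingType) (n : nat).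

Local Notation L := (laurent R n).

HB.instance Definition _ := GRing.Lmodule.on L.

Implicit Types (g : L) (k : expo n).

Definition lone : L := << (0 : expo n) >>.

Definition lmul g1 g2 : L :=
  \sum_(k1 <- msupp g1) \sum_(k2 <- msupp g2) << g1@_k1 * g2@_k2 *g (k1 + k2) >>.

Lemma lmulr g1 g2 :
  lmul g1 g2 = \sum_(k2 <- msupp g2) \sum_(k1 <- msupp g1)
                 << g1@_k1 * g2@_k2 *g (k1 + k2) >>.
Proof. by rewrite /lmul exchange_big. Qed.

Lemma lmullw (d1 d2 : {fset expo n}) g1 g2 :
  msupp g1 `<=` d1 -> msupp g2 `<=` d2 ->
  lmul g1 g2 = \sum_(k1 <- d1) \sum_(k2 <- d2) << g1@_k1 * g2@_k2 *g (k1 + k2) >>.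
Proof.
move=> le_d1 le_d2; rewrite /lmul (big_fset_incl _ le_d1) /=.
  apply/eq_bigr=> k1 _; apply/big_fset_incl => // k _ /mcoeff_outdom ->.
  by rewrite mulr0 monalgU0.
move=> k _ /mcoeff_outdom g1k.
by rewrite big1 => // k' _; rewrite g1k mul0r monalgU0.
Qed.

Lemma lmulrw (d1 d2 : {fset expo n}) g1 g2 : msupp g1 `<=` d1 -> msupp g2 `<=` d2
  -> lmul g1 g2 = \sum_(k2 <- d2) \sum_(k1 <- d1) << g1@_k1 * g2@_k2 *g (k1 + k2) >>.
Proof. by move=> le_d1 le_d2; rewrite (lmullw le_d1 le_d2) exchange_big. Qed.

Lemma lmul0g : left_zero 0 lmul.
Proof. by move=> g; rewrite /lmul msupp0 big_seq_fset0. Qed.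

Lemma lmulg0 : right_zero 0 lmul.
Proof. by move=> g; rewrite lmulr msupp0 big_seq_fset0. Qed.

Lemma lmulUg c k g :
  lmul << c *g k >> g = \sum_(k' <- msupp g) << c * g@_k' *g (k + k') >>.
Proof.
rewrite (lmullw msuppU_le (fsubset_refl _)) big_seq_fset1.
by apply/eq_bigr => k' _; rewrite mcoeffUU.
Qed.

Lemma lmulgU c k g :
  lmul g << c *g k >> = \sum_(k' <- msupp g) << g@_k' * c *g (k' + k) >>.
Proof.
rewrite (lmulrw (fsubset_refl _) msuppU_le) big_seq_fset1.
by apply/eq_bigr=> k' _; rewrite mcoeffUU.
Qed.

Lemma lmulUU c1 c2 k1 k2 :
  lmul << c1 *g k1 >> << c2 *g k2 >> = << c1 * c2 *g (k1 + k2) >>.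
Proof. by rewrite (lmulrw msuppU_le msuppU_le) !big_seq_fset1 !mcoeffUU. Qed.

Lemma lmulEl1 g1 g2 :
  lmul g1 g2 = \sum_(k1 <- msupp g1) lmul << g1@_k1 *g k1 >> g2.
Proof. by apply/eq_bigr=> k _; rewrite lmulUg. Qed.

Lemma lmulEr1 g1 g2 :
  lmul g1 g2 = \sum_(k2 <- msupp g2) lmul g1 << g2@_k2 *g k2 >>.
Proof. by rewrite lmulr; apply/eq_bigr=> k _; rewrite lmulgU. Qed.

Lemma lmul1g : left_id lone lmul.
Proof.
move=> g; rewrite lmulUg [RHS]monalgE.
by apply/eq_bigr=> kg _; rewrite mul1r add0r.
Qed.

Lemma lmulg1 : right_id lone lmul.
Proof.
move=> g; rewrite lmulgU [RHS]monalgE.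
by apply/eq_bigr=> k _; rewrite mulr1 addr0.
Qed.

Lemma lmulgDl : left_distributive lmul +%R.
Proof.
move=> g1 g2 g.
rewrite [in RHS](lmullw (fsubsetUl _ (msupp g2)) (fsubset_refl (msupp g))).
rewrite [in RHS](lmullw (fsubsetUr (msupp g1) _) (fsubset_refl (msupp g))).
rewrite (lmullw (msuppD_le _ _) (fsubset_refl (msupp g))).
rewrite -big_split /=; apply/eq_bigr=> k1 _.
rewrite -big_split /=; apply/eq_bigr=> k2 _.
by rewrite mcoeffD mulrDl monalgUD.
Qed.

Lemma lmulgDr : right_distributive lmul +%R.
Proof.
move=> g g1 g2.
rewrite [in RHS](lmulrw (fsubset_refl (msupp g)) (fsubsetUl _ (msupp g2))).
rewrite [in RHS](lmulrw (fsubset_refl (msupp g)) (fsubsetUr (msupp g1) _)).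
rewrite (lmulrw (fsubset_refl (msupp g)) (msuppD_le _ _)).
rewrite -big_split /=; apply/eq_bigr => k1 _.
rewrite -big_split /=; apply/eq_bigr => k2 _.
by rewrite mcoeffD mulrDr monalgUD.
Qed.

Lemma lmulA : associative lmul.
Proof.
move=> g1 g2 g3.
rewrite [RHS](big_morph (lmul^~ _) (fun _ _ => lmulgDl _ _ _) (lmul0g _)).
rewrite lmulEl1; apply/eq_bigr=> k1 _.
rewrite [LHS](big_morph (lmul _) (fun _ _ => lmulgDr _ _ _) (lmulg0 _)).
rewrite [RHS](big_morph (lmul^~ _) (fun _ _ => lmulgDl _ _ _) (lmul0g _)).
apply/eq_bigr=> k2 _.
rewrite [LHS](big_morph (lmul _) (fun _ _ => lmulgDr _ _ _) (lmulg0 _)).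
by rewrite lmulEr1; apply/eq_bigr=> k3 _; rewrite !lmulUU mulrA addrA.
Qed.

Lemma lmulC : commutative lmul.
Proof.
move=> g1 g2; rewrite lmulr /lmul; apply/eq_bigr=> k2 _; apply/eq_bigr=> k1 _.
by rewrite mulrC addrC.
Qed.

Lemma lone_neq0 : lone != 0 :> L.
Proof.
apply/eqP/malgP=> /(_ 0) /eqP; rewrite mcoeffUU mcoeff0 oner_eq0 //.
Qed.

HB.instance Definition _ := GRing.Zmodule_isComNzRing.Build L
  lmulA lmulC lmul1g lmulgDl lone_neq0.

Lemma lscaleE (c : R) (g : L) : c *: g = (<< c *g (0 : expo n) >> : L) * g.
Proof.
rewrite [RHS]lmulUg; apply/eq_bigr=> k _; by rewrite add0r.
Qed.

Lemma lscaleAl (c : R) (g1 g2 : L) : c *: (g1 * g2) = (c *: g1) * g2.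
Proof. by rewrite !lscaleE mulrA. Qed.

HB.instance Definition _ := GRing.Lmodule_isLalgebra.Build R L lscaleAl.
HB.instance Definition _ := GRing.Lalgebra_isComAlgebra.Build R L.

End LaurentRing.

Section Witt.
Context (K : fieldType) (n : nat).

Local Notation L := (laurent K n).

Definition xmon (k : expo n) : L := << (1 : K) *g k >>.

Definition xvar (i : 'I_n) : L := xmon (delta_mx 0 i).

Definition alg_aut (s : L -> L) : Prop :=
  [/\ (forall (c : K) (f g : L), s (c *: f + g) = c *: s f + s g),
      (forall f g : L, s (f * g) = s f * s g),
      s 1 = 1
    & bijective s].

Definition derivation (d : L -> L) : Prop :=
  (forall (c : K) (f g : L), d (c *: f + g) = c *: d f + d g) /\
  (forall f g : L, d (f * g) = f * d g + d f * g).

Definition lie_bracket (d e : L -> L) : L -> L := fun f => d (e f) - e (d f).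

Definition lie_aut (phi : (L -> L) -> (L -> L)) : Prop :=
  [/\ (forall d, derivation d -> derivation (phi d)),
      (forall (c : K) d e, derivation d -> derivation e ->
          phi (fun f => c *: d f + e f) = (fun f => c *: phi d f + phi e f)),
      (forall d e, derivation d -> derivation e ->
          phi (lie_bracket d e) = lie_bracket (phi d) (phi e))
    & (forall e, derivation e -> exists! d, derivation d /\ phi d = e)].

End Witt.

Arguments xmon {K n} k.
Arguments xvar {K n} i.
Arguments alg_aut {K n} s.
Arguments derivation {K n} d.
Arguments lie_bracket {K n} d e f.
Arguments lie_aut {K n} phi.

(* Main.v *)
(* Write D_h = sum_i h_i x_i d/dx_i, so that W_n is graded by Z^n with
   components x^a D_h, on which ad D_h' acts by the scalar <h', a>.  The D_h are
   exactly the ad-locally finite derivations: if d involves another exponent,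
   choose an additive Z-valued functional that is injective on the exponents of
   d; its extremal term makes the iterates of ad d on a suitable x^b D_h
   linearly independent.  So a Lie automorphism phi preserves {D_h}, hence
   permutes the weight spaces by an integral matrix G:
   phi (x^a D_h) = x^(aG) D_(T_a h).  If <h, b> = 0, bracketing x^a D_h with
   x^b D_h' for some h' <> 0 with <h', a> = 0 gives 0, and comparing b with 2b
   shows <T_a h, bG> = 0.  This forces T_a = c(a) T_0 with c a character of Z^n,
   and phi is conjugation by x^a |-> c(a) x^(aG).  Units of L_n are monomials,
   by looking at extremal exponents again, whence the description of
   Aut(L_n). *)
Require Import Defs.
From HB Require Import structures.
From mathcomp Require Import all_boot all_order all_algebra.
From mathcomp Require Import finmap.
From mathcomp.multinomials Require Import monalg.
From Stdlib Require Import FunctionalExtensionality.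
From mathcomp Require Import ring zify.
Import Order.TTheory GRing.Theory Num.Theory.
Local Open Scope ring_scope.

Set Implicit Arguments.
Unset Strict Implicit.
Unset Printing Implicit Defensive.

(* The concrete [laurent K n] enters only through this interface: unification
   of its canonical structures, inherited from [malg], is prohibitively slow. *)
Record monomial_basis (K : fieldType) (n : nat) (L : comAlgType K) := MonomialBasis {
  mon : expo n -> L;
  coef : expo n -> L -> K;
  supp : L -> seq (expo n);
  mon0 : mon 0 = 1;
  monD : forall a b, mon (a + b) = mon a * mon b;
  coef_linear : forall k c f g, coef k (c *: f + g) = c * coef k f + coef k g;
  coef_mon : forall a k, coef k (mon a) = (a == k)%:R;
  mem_supp : forall f k, (k \in supp f) = (coef k f != 0);
  supp_uniq : forall f, uniq (supp f);
  monE : forall f, f = \sum_(k <- supp f) coef k f *: mon k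
}.

Lemma row_neq0 (R : nmodType) (n : nat) (v : 'rV[R]_n) :
  v != 0 -> exists i, v 0 i != 0.
Proof.
move=> v0; apply/existsP; apply: contra_neqT v0 => /existsPn v0.
by apply/rowP => i; rewrite [RHS]mxE; apply/eqP; have := v0 i; rewrite negbK.
Qed.

(** * Additive functionals on the exponent lattice *)

Section Exponents.
Context (n : nat).
Local Notation E := (expo n).
Implicit Types (a b k : E).

Lemma expo_sum_delta a : a = \sum_i delta_mx 0 i *~ a 0 i.
Proof.
rewrite {1}(row_sum_delta a); apply: eq_bigr => i _.
by rewrite -scaler_int intz.
Qed.

Lemma expo_additive (V : zmodType) (u : E -> V) :
  (forall a b, u (a + b) = u a + u b) ->
  forall a, u a = \sum_i u (delta_mx 0 i) *~ a 0 i.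
Proof.
move=> uD; have u0 : u 0 = 0 by apply: (addrI (u 0)); rewrite -uD !addr0.
have uN a : u (- a) = - u a by apply: (addrI (u a)); rewrite -uD !subrr.
have un a m : u (a *+ m) = u a *+ m.
  by elim: m => [|m IHm]; rewrite ?mulr0n // !mulrS uD IHm.
have uz a z : u (a *~ z) = u a *~ z.
  by case: z => m; rewrite ?NegzE ?mulrNz ?uN -?pmulrn un.
move=> a; rewrite {1}(expo_sum_delta a).
by elim/big_rec2: _ => // i v b _ <-; rewrite uD uz.
Qed.

(** By induction: if the functional found for the tail kills the new vector [v], add to a large
    multiple of it a coordinate that is nonzero on [v]. *)
Lemma additive_nonzero_on (V : seq E) : 0 \notin V ->
  exists2 l : E -> int, {morph l : a b / a + b} & {in V, forall a, l a != 0}.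
Proof.
elim: V => [|v V IHV]; first by exists (fun=> 0) => // a b; rewrite addr0.
rewrite in_cons negb_or eq_sym => /andP[v0 /IHV[l lD lV]].
have [lv0|lv] := eqVneq (l v) 0; last first.
  by exists l => // a; rewrite in_cons => /predU1P[->|/lV].
have [i vi] := row_neq0 v0.
(* [M] exceeds the [i]-th coordinate of every vector in [V] in absolute value, so that coordinate
   cannot cancel [M] times a nonzero integer. *)
pose M : int := 1 + \sum_(u <- V) `|u 0 i|.
exists (fun a => M * l a + a 0 i) => [a b|a].
  by rewrite lD mulrDr mxE addrACA.
rewrite in_cons => /predU1P[->|aV]; first by rewrite lv0 mulr0 add0r.
have aM : `|a 0 i| < M.
  rewrite /M (big_rem a) //= addrCA ltrDl ltr_pwDl // sumr_ge0 // => *.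
rewrite addr_eq0; apply: contraTneq aM => E1; rewrite -leNgt -normrN -E1 normrM.
have M0 : 0 <= M by rewrite /M addr_ge0 // sumr_ge0.
by rewrite (ger0_norm M0) ler_peMr // -gtz0_ge1 normr_gt0 lV.
Qed.

(** Injectivity on [S] amounts to not vanishing on the finitely many nonzero differences of its
    elements. *)
Lemma additive_inj_on (S : seq E) :
  exists2 l : E -> int, {morph l : a b / a + b} & {in S &, injective l}.
Proof.
pose V := [seq p.1 - p.2 | p <- [seq (a, b) | a <- S, b <- S] & p.1 != p.2].
have [|l lD lV] := @additive_nonzero_on V.
  apply/mapP => -[p]; rewrite mem_filter => /andP[p0 _] /esym/eqP.
  by rewrite subr_eq0 (negPf p0).
exists l => // a b aS bS lab; apply/eqP; apply: contraT => ab.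
suff /lV/eqP[] : a - b \in V.
  by apply: (addIr (l b)); rewrite -lD subrK lab add0r.
by apply/mapP; exists (a, b) => //; rewrite mem_filter ab /= allpairs_f.
Qed.

Lemma seq_argmax (l : E -> int) (S : seq E) : S != [::] ->
  exists2 a, a \in S & {in S, forall b, l b <= l a}.
Proof.
elim: S => // b [|b' S] IHS _.
  by exists b; rewrite ?mem_head // => a; rewrite inE => /eqP->.
have [//|a aS amax] := IHS.
have [lab|lab] := leP (l a) (l b).
  exists b; rewrite ?mem_head // => a'; rewrite in_cons => /predU1P[->//|/amax].
  by move/le_trans; apply.
exists a => [|a']; first by rewrite in_cons aS orbT.
by rewrite in_cons => /predU1P[->|/amax//]; apply: ltW.
Qed.

End Exponents.

(** * The pairing of [K^n] with exponents *)

Section Pairing.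
Context (K : fieldType) (n : nat).
Local Notation E := (expo n).
Implicit Types (a b k : E) (c : K) (h : 'rV[K]_n).

(** The eigenvalue of [sum_i h_i x_i d/dx_i] on [x^a], as a matrix product so that linear changes of
    exponents pass to [h] by transposition. *)
Definition dot h a : K := (h *m (map_mx intr a)^T) 0 0.

Lemma dotE h a : dot h a = \sum_i h 0 i * (a 0 i)%:~R.
Proof. by rewrite /dot mxE; apply: eq_bigr => i _; rewrite !mxE. Qed.

Lemma dotDl h1 h2 a : dot (h1 + h2) a = dot h1 a + dot h2 a.
Proof. by rewrite /dot mulmxDl mxE. Qed.
Lemma dotZl c h a : dot (c *: h) a = c * dot h a.
Proof. by rewrite /dot -scalemxAl mxE. Qed.
Lemma dot0l a : dot 0 a = 0.
Proof. by rewrite /dot mul0mx mxE. Qed.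
Lemma dotDr h a b : dot h (a + b) = dot h a + dot h b.
Proof. by rewrite /dot map_mxD linearD /= mulmxDr mxE. Qed.
Lemma dotNr h a : dot h (- a) = - dot h a.
Proof. by rewrite /dot map_mxN linearN /= mulmxN mxE. Qed.
Lemma dotBr h a b : dot h (a - b) = dot h a - dot h b.
Proof. by rewrite dotDr dotNr. Qed.
Lemma dot0r h : dot h 0 = 0.
Proof. by rewrite /dot map_mx0 trmx0 mulmx0 mxE. Qed.
Lemma dotMnr h a m : dot h (a *+ m) = dot h a *+ m.
Proof. by elim: m => [|m IHm]; rewrite ?mulr0n ?dot0r // !mulrS dotDr IHm. Qed.

Lemma dot_mulmxr h a (G : 'M[int]_n) :
  dot h (a *m G) = dot (h *m (map_mx intr G)^T) a.
Proof. by rewrite /dot map_mxM trmx_mul mulmxA. Qed.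

Lemma dot_deltal i a : dot (delta_mx 0 i) a = (a 0 i)%:~R.
Proof.
rewrite dotE (bigD1 i) //= big1 ?addr0 ?mxE ?eqxx ?mul1r // => j ji.
by rewrite mxE eqxx (negPf ji) mul0r.
Qed.

Lemma dot_deltar i h : dot h (delta_mx 0 i) = h 0 i.
Proof.
rewrite dotE (bigD1 i) //= big1 ?addr0 ?mxE ?eqxx ?mulr1 // => j ji.
by rewrite mxE eqxx (negPf ji) mulr0.
Qed.

End Pairing.

(** * Coefficients, linear maps and derivations in a monomial basis *)

Section LinearMaps.
Context (K : fieldType) (n : nat) (L : comAlgType K) (B : monomial_basis n L).
Local Notation E := (expo n).
Local Notation X := (mon B).
Local Notation cf := (coef B).
Implicit Types (a b k : E) (c : K) (f g : L).

Lemma monNK a f : X (- a) * (X a * f) = f.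
Proof. by rewrite mulrA -monD addNr mon0 mul1r. Qed.

Lemma mon_neq0 a : X a != 0.
Proof.
apply/eqP => Xa; have /eqP[] := oner_neq0 L.
by rewrite -(mon0 B) -(addNr a) monD Xa mulr0.
Qed.

Lemma coefD k f g : cf k (f + g) = cf k f + cf k g.
Proof. by rewrite -{1}[f]scale1r coef_linear mul1r. Qed.

Lemma coef0 k : cf k 0 = 0.
Proof. by apply: (addrI (cf k 0)); rewrite -coefD !addr0. Qed.

Lemma coefZ k c f : cf k (c *: f) = c * cf k f.
Proof. by rewrite -{1}[c *: f]addr0 coef_linear coef0 addr0. Qed.

Lemma coefN k f : cf k (- f) = - cf k f.
Proof. by rewrite -scaleN1r coefZ mulN1r. Qed.

Lemma coefB k f g : cf k (f - g) = cf k f - cf k g.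
Proof. by rewrite coefD coefN. Qed.

Lemma coef_sum k I (r : seq I) (F : I -> L) :
  cf k (\sum_(i <- r) F i) = \sum_(i <- r) cf k (F i).
Proof.
by elim: r => [|i r IHr]; rewrite ?big_nil ?coef0 // !big_cons coefD IHr.
Qed.

Lemma coef_out k f : k \notin supp B f -> cf k f = 0.
Proof. by rewrite mem_supp negbK => /eqP. Qed.

Lemma supp_nil f : supp B f = [::] -> f = 0.
Proof. by move=> f0; rewrite (monE B f) f0 big_nil. Qed.

Lemma coef_inj f g : (forall k, cf k f = cf k g) -> f = g.
Proof.
move=> fg; apply/eqP; rewrite -subr_eq0; apply/eqP/supp_nil.
case E1: (supp B (f - g)) => [//|k s].
have := mem_head k s; rewrite -E1 mem_supp coefB fg subrr eqxx; done.
Qed.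

Lemma mon_scale_inj c c' a a' : c != 0 ->
  c *: X a = c' *: X a' -> c = c' /\ a = a'.
Proof.
move=> c0 e; have := congr1 (cf a) e; rewrite !coefZ !coef_mon eqxx mulr1.
case: (eqVneq a' a) => [->|_]; first by rewrite mulr1.
by rewrite mulr0 => cc; rewrite cc eqxx in c0.
Qed.

Definition linear_map (s : L -> L) : Prop :=
  forall c f g, s (c *: f + g) = c *: s f + s g.

Lemma linear_map0 s : linear_map s -> s 0 = 0.
Proof. by move=> ls; have := ls (-1) 0 0; rewrite !scaleN1r !addNr. Qed.

Lemma linear_mapZ s c f : linear_map s -> s (c *: f) = c *: s f.
Proof. by move=> ls; have := ls c f 0; rewrite (linear_map0 ls) !addr0. Qed.

Lemma linear_mapD s f g : linear_map s -> s (f + g) = s f + s g.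
Proof. by move=> ls; have := ls 1 f g; rewrite !scale1r. Qed.

Lemma linear_map_sum s I (r : seq I) (F : I -> L) :
  linear_map s -> s (\sum_(i <- r) F i) = \sum_(i <- r) s (F i).
Proof.
move=> ls; elim: r => [|i r IHr]; first by rewrite !big_nil linear_map0.
by rewrite !big_cons linear_mapD ?IHr.
Qed.

Lemma linear_map_eq s t : linear_map s -> linear_map t ->
  (forall k, s (X k) = t (X k)) -> s =1 t.
Proof.
move=> ls lt st f; rewrite (monE B f) !linear_map_sum //.
by apply: eq_bigr => k _; rewrite !linear_mapZ // st.
Qed.

Lemma linear_map_comp s t : linear_map s -> linear_map t -> linear_map (s \o t).
Proof. by move=> ls lt c f g /=; rewrite lt ls. Qed.

Lemma coef_monM a f k : cf k (X a * f) = cf (k - a) f.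
Proof.
rewrite {1}(monE B f) mulr_sumr [in RHS](monE B f) !coef_sum.
apply: eq_bigr => b _; rewrite -scalerAr -monD !coefZ !coef_mon.
by rewrite [b == _]eq_sym subr_eq (addrC b) (eq_sym k).
Qed.

Lemma coefM f g k : cf k (f * g) = \sum_(a <- supp B f) cf a f * cf (k - a) g.
Proof.
rewrite {1}(monE B f) mulr_suml coef_sum; apply: eq_bigr => a _.
by rewrite -scalerAl coefZ coef_monM.
Qed.

Definition linext (F : E -> L) f : L := \sum_(k <- supp B f) cf k f *: F k.

Lemma linext_wide F f (S : seq E) : uniq S -> {subset supp B f <= S} ->
  linext F f = \sum_(k <- S) cf k f *: F k.
Proof.
move=> uS fS; rewrite [RHS](bigID (mem (supp B f))) /= addrC big1 => [|k].
  rewrite add0r -big_filter; apply: perm_big; apply: uniq_perm.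
  - exact: supp_uniq.
  - exact: filter_uniq.
  by move=> k; rewrite mem_filter; apply/idP/andP => [kf|[]//]; split=> //; apply: fS.
by move=> /coef_out->; rewrite scale0r.
Qed.

Lemma linext_linear F : linear_map (linext F).
Proof.
move=> c f g; pose S := undup (supp B (c *: f + g) ++ supp B f ++ supp B g).
rewrite !(@linext_wide F _ S) ?undup_uniq //.
- rewrite scaler_sumr -big_split; apply: eq_bigr => k _ /=.
  by rewrite coef_linear scalerDl scalerA.
all: by move=> k kf; rewrite mem_undup !mem_cat kf ?orbT.
Qed.

Lemma linext_mon F k : linext F (X k) = F k.
Proof.
rewrite (linext_wide F (S := [:: k])) // ?big_seq1 ?coef_mon ?eqxx ?scale1r //.
move=> a; rewrite mem_supp coef_mon inE (eq_sym a).
by case: (k == a) => //; rewrite eqxx.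
Qed.

Lemma linear_mapM s : linear_map s ->
  (forall a b, s (X (a + b)) = s (X a) * s (X b)) ->
  forall f g, s (f * g) = s f * s g.
Proof.
move=> ls sM f g.
apply: (linear_map_eq (s := fun g => s (f * g)) (t := fun g => s f * s g)).
- by move=> c g1 g2; rewrite mulrDr -scalerAr ls.
- by move=> c g1 g2; rewrite ls mulrDr -scalerAr.
move=> b; apply: (linear_map_eq (s := fun f => s (f * X b))
                                (t := fun f => s f * s (X b))).
- by move=> c g1 g2; rewrite mulrDl -scalerAl ls.
- by move=> c g1 g2; rewrite ls mulrDl -scalerAl.
by move=> a; rewrite -monD sM.
Qed.

Definition is_derivation (d : L -> L) : Prop :=
  linear_map d /\ forall f g, d (f * g) = f * d g + d f * g.

Lemma linear_map_derivation d : linear_map d ->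
  (forall a b, d (X (a + b)) = X a * d (X b) + d (X a) * X b) ->
  is_derivation d.
Proof.
move=> ld dM; split=> // f g.
apply: (linear_map_eq (s := fun g => d (f * g)) (t := fun g => f * d g + d f * g)).
- by move=> c g1 g2; rewrite mulrDr -scalerAr ld.
- by move=> c g1 g2; rewrite ld !mulrDr -!scalerAr scalerDr addrACA.
move=> b; apply: (linear_map_eq (s := fun f => d (f * X b))
                     (t := fun f => f * d (X b) + d f * X b)).
- by move=> c g1 g2; rewrite mulrDl -scalerAl ld.
- by move=> c g1 g2; rewrite ld !mulrDl -!scalerAl scalerDr addrACA.
by move=> a; rewrite -monD dM.
Qed.

End LinearMaps.

(** * Units and algebra automorphisms *)

Section Automorphisms.
Context (K : fieldType) (n : nat) (L : comAlgType K) (B : monomial_basis n L).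
Local Notation E := (expo n).
Local Notation X := (mon B).
Local Notation cf := (coef B).

Implicit Types (a b k : E) (f g : L).

(** Any other pair of exponents with sum [a + b] has a first member below [l a], hence a second one
    above [l b], outside the support of [g]. *)
Lemma coefM_top (l : E -> int) f g a b : {morph l : x y / x + y} ->
  {in supp B f, forall k, k != a -> l k < l a} ->
  {in supp B g, forall k, l k <= l b} ->
  cf (a + b) (f * g) = cf a f * cf b g.
Proof.
move=> lD fa gb; rewrite coefM.
have zero k : k \in supp B f -> k != a -> cf (a + b - k) g = 0.
  move=> kf ka; apply/coef_out; apply: contraTN (fa k kf ka) => /gb.
  rewrite -(lerD2r (l k)) -lD subrK lD addrC lerD2l => la.
  by rewrite -leNgt.
have [af|af] := boolP (a \in supp B f); last first.
  rewrite (coef_out af) mul0r big1_seq // => k /= kf.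
  by rewrite zero ?mulr0 //; apply: contraNneq af => <-.
rewrite (big_rem a) //= [V in _ + V]big1_seq ?addr0; first last.
  move=> k; rewrite /= mem_rem_uniq ?supp_uniq // => /andP[ka kf].
  by rewrite zero // mulr0.
by rewrite addrAC subrr add0r.
Qed.

(** The product of the two top coefficients is nonzero, so [a + b] is an exponent of [f * g], whose
    only exponent is 0. *)
Lemma mul_eq1_top (l : E -> int) f g a b : {morph l : x y / x + y} ->
  {in supp B f &, injective l} -> a \in supp B f -> b \in supp B g ->
  {in supp B f, forall k, l k <= l a} -> {in supp B g, forall k, l k <= l b} ->
  f * g = 1 -> a + b = 0.
Proof.
move=> lD linj af bg amax bmax fg; apply/eqP; apply: contraT => ab0.
have : cf (a + b) (f * g) != 0.
  rewrite (coefM_top lD _ bmax) ?mulf_neq0 -?mem_supp // => k kf ka.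
  by rewrite lt_neqAle amax // andbT; apply: contra_neq ka; apply: linj.
by rewrite fg -(mon0 B) coef_mon (eq_sym 0) (negPf ab0) eqxx.
Qed.

(** The maxima of [l] on the two supports add up to zero, and so do the minima. Hence maximum and
    minimum agree on the support of [f], and injectivity of [l] leaves a single exponent. *)
Lemma mul_eq1_monomial f g : f * g = 1 ->
  exists c a, c != 0 /\ f = c *: X a.
Proof.
move=> fg.
have nz f1 g1 : f1 * g1 = 1 -> supp B f1 != [::].
  move=> fg1; apply: contraTneq (oner_neq0 L) => f10; rewrite negbK -fg1.
  by rewrite (monE B f1) f10 big_nil mul0r.
have [l lD linj] := additive_inj_on (supp B f ++ supp B g).
have [a af amax] := seq_argmax l (nz _ _ fg).
have fg' := fg; rewrite mulrC in fg'.
have [b bg bmax] := seq_argmax l (nz _ _ fg').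
have [a' af' amin] := seq_argmax (fun k => - l k) (nz _ _ fg).
have [b' bg' bmin] := seq_argmax (fun k => - l k) (nz _ _ fg').
have linjf : {in supp B f &, injective l}.
  by move=> x y xf yf; apply: linj; rewrite mem_cat ?xf ?yf.
have ab0 : a + b = 0 by apply: (mul_eq1_top lD linjf af bg amax bmax fg).
have ab0' : a' + b' = 0.
  apply: (mul_eq1_top _ _ af' bg' amin bmin fg) => [x y|x y xf yf /oppr_inj].
    by rewrite lD opprD.
  exact: linjf.
have laa' : l a <= l a'.
  have E1 : l a + l b = l a' + l b' by rewrite -!lD ab0 ab0'.
  have := bmin _ bg; rewrite lerN2 => lb.
  by rewrite -(lerD2r (l b)) E1 lerD2l.
exists (cf a f), a; split; first by rewrite -mem_supp.
apply: (@coef_inj _ _ _ B) => k; rewrite coefZ coef_mon.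
have [->|ak] := eqVneq a k; first by rewrite mulr1.
rewrite mulr0; apply/coef_out; apply: contra ak => kf; apply/eqP.
apply: linjf => //; apply/eqP; rewrite eq_le amax // andbT.
by apply: le_trans laa' _; have := amin _ kf; rewrite lerN2.
Qed.

Definition is_alg_aut (s : L -> L) : Prop :=
  [/\ linear_map s, (forall f g, s (f * g) = s f * s g), s 1 = 1 & bijective s].

Lemma alg_aut_xmon (s : L -> L) k : is_alg_aut s ->
  exists c a, c != 0 /\ s (X k) = c *: X a.
Proof.
case=> _ sM s1 _; apply: (@mul_eq1_monomial _ (s (X (- k)))).
by rewrite -sM -monD subrr mon0.
Qed.

(** The scalars are a function of the exponent rather than an [n]-tuple, because this is the form in
    which a Lie automorphism supplies them. *)
Definition laut (G : 'M[int]_n) (c : E -> K) : L -> L :=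
  linext B (fun k => c k *: X (k *m G)).

Definition expo_char (c : E -> K) : Prop :=
  (forall a b, c (a + b) = c a * c b) /\ c 0 = 1.

Lemma lautU G (c : E -> K) k : laut G c (X k) = c k *: X (k *m G).
Proof. exact: linext_mon. Qed.

Lemma expo_char_neq0 (c : E -> K) a : expo_char c -> c a != 0.
Proof.
case=> cD c0; apply/eqP => ca; have /eqP[] := oner_neq0 K.
by rewrite -c0 -(subrr a) cD ca mul0r.
Qed.

Lemma laut_linear G (c : E -> K) : linear_map (laut G c).
Proof. exact: linext_linear. Qed.

Lemma laut_mul G c f g : expo_char c -> laut G c (f * g) = laut G c f * laut G c g.
Proof.
case=> cD _; apply: (linear_mapM (B := B)) (laut_linear G c) _ f g => a b.
by rewrite !lautU cD mulmxDl monD -scalerAl -scalerAr scalerA.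
Qed.

Lemma laut1 G c : expo_char c -> laut G c 1 = 1.
Proof. by case=> _ c0; rewrite -(mon0 B) lautU c0 scale1r mul0mx. Qed.

(** The second map meets the exponent [k *m G], so its scalar must first undo [G] by [G'] and then
    invert [c]. *)
Lemma laut_cancel G G' (c : E -> K) :
  expo_char c -> G *m G' = 1%:M -> G' *m G = 1%:M ->
  cancel (laut G c) (laut G' (fun k => (c (k *m G'))^-1)).
Proof.
move=> cc GG' GG f; set t := laut G' _.
apply: (linear_map_eq (B := B) (s := t \o laut G c) (t := id)) => // [|k].
  by apply: linear_map_comp; apply: laut_linear.
rewrite /= lautU linear_mapZ /t ?lautU; last exact: laut_linear.
by rewrite -mulmxA GG' mulmx1 scalerA mulfV ?scale1r ?expo_char_neq0.
Qed.

Lemma expo_charV G c : expo_char c -> expo_char (fun k => (c (k *m G))^-1).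
Proof.
case=> cD c0; split=> [a b|]; first by rewrite mulmxDl cD invfM.
by rewrite mul0mx c0 invr1.
Qed.

Lemma laut_alg_aut G c : expo_char c -> G \in unitmx -> is_alg_aut (laut G c).
Proof.
move=> cc Gu; split; [exact: laut_linear|by move=> *; apply: laut_mul|exact: laut1|].
exists (laut (invmx G) (fun k => (c (k *m invmx G))^-1)).
  by apply: laut_cancel; rewrite ?mulmxV ?mulVmx.
(* Cancellation for the inverse pair returns [laut G] with a doubly inverted character, which is [c]
   again. *)
move=> f; have := laut_cancel (expo_charV (invmx G) cc) (mulVmx Gu) (mulmxV Gu) f.
set u := laut G _; have -> // : u = laut G c.
rewrite /u /laut; congr linext; apply: functional_extensionality => k.
by rewrite -mulmxA mulmxV // mulmx1 invrK.
Qed.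

Definition torus_char (lam : 'rV[K]_n) k : K := \prod_i lam 0 i ^ k 0 i.

Lemma torus_char_char (lam : 'rV[K]_n) :
  (forall i, lam 0 i != 0) -> expo_char (torus_char lam).
Proof.
move=> lam0; split=> [a b|]; last by apply: big1 => i _; rewrite mxE.
by rewrite -big_split; apply: eq_bigr => i _; rewrite mxE expfzDr.
Qed.

Lemma torus_char_delta (lam : 'rV[K]_n) i : torus_char lam (delta_mx 0 i) = lam 0 i.
Proof.
rewrite /torus_char (bigD1 i) //= mxE !eqxx expr1z big1 ?mulr1 // => j ji.
by rewrite mxE (negPf ji).
Qed.

Lemma delta_mulmx_tr (A : 'M[int]_n) i : delta_mx 0 i *m A^T = \row_j A j i.
Proof. by rewrite -rowE; apply/rowP => j; rewrite !mxE. Qed.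

(** The quotient of [s (X k)] by [t (X k)] is multiplicative in [k], so it is trivial once it is
    trivial on a basis of [Z^n]. *)
Lemma alg_hom_eq (s t : L -> L) :
  linear_map s -> linear_map t ->
  (forall f g, s (f * g) = s f * s g) -> (forall f g, t (f * g) = t f * t g) ->
  s 1 = 1 -> t 1 = 1 ->
  (forall i, s (X (delta_mx 0 i)) = t (X (delta_mx 0 i))) -> s =1 t.
Proof.
move=> ls lt sM tM s1 t1 st; apply: (linear_map_eq (B := B)) => // k.
pose u k := s (X k) * t (X (- k)).
have uD a b : u (a + b) = u a * u b.
  by rewrite /u opprD !monD sM tM mulrACA.
have tV a : t (X a) * t (X (- a)) = 1 by rewrite -tM -monD subrr mon0.
suff uk : u k = 1.
  by rewrite -[LHS]mulr1 -(tV k) mulrCA [_ * t _]uk mulr1.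
have u1 i : u (delta_mx 0 i) = 1 by rewrite /u st tV.
have u0 : u 0 = 1 by rewrite /u oppr0 mon0 s1 t1 mulr1.
have uN a : u a = 1 -> u (- a) = 1.
  by move=> ua; have := uD a (- a); rewrite subrr u0 ua mul1r.
have un a m : u a = 1 -> u (a *+ m) = 1.
  by move=> ua; elim: m => [|m IHm]; rewrite ?mulr0n // mulrS uD ua IHm mulr1.
rewrite (expo_sum_delta k); elim/big_ind: _ => // [a b ua ub|i _].
  by rewrite uD ua ub mulr1.
case: (k 0 i) => m; first by rewrite -pmulrn un.
by rewrite NegzE mulrNz uN // -pmulrn un.
Qed.

Lemma laut_exists (A : 'M[int]_n) (lam : 'rV[K]_n) : A \in unitmx ->
  (forall i, lam 0 i != 0) ->
  exists s, is_alg_aut s /\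
    forall i, s (X (delta_mx 0 i)) = lam 0 i *: X (\row_j A j i).
Proof.
(* The exponent of the image of [x_i] is column [i] of [A], while [laut] multiplies row vectors on
   the right; hence the transpose. *)
move=> Au lam0; exists (laut A^T (torus_char lam)); split=> [|i].
  by apply: laut_alg_aut; [exact: torus_char_char|rewrite unitmx_tr].
by rewrite lautU torus_char_delta delta_mulmx_tr.
Qed.

Lemma alg_aut_laut (s : L -> L) (A : 'M[int]_n) (lam : 'rV[K]_n) : is_alg_aut s ->
  (forall i, s (X (delta_mx 0 i)) = lam 0 i *: X (\row_j A j i)) ->
  (forall i, lam 0 i != 0) /\ s =1 laut A^T (torus_char lam).
Proof.
move=> sa sx; have [ls sM s1 sb] := sa.
have lam0 i : lam 0 i != 0.
  apply/eqP => l0; have /eqP[] := mon_neq0 B (delta_mx 0 i).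
  by apply: (bij_inj sb); rewrite sx l0 scale0r linear_map0.
split=> //; have cc := torus_char_char lam0.
apply: alg_hom_eq => //.
- exact: laut_linear.
- by move=> *; apply: laut_mul.
- exact: laut1.
by move=> i; rewrite lautU torus_char_delta delta_mulmx_tr.
Qed.

Lemma supp_laut G c f k : k \in supp B (laut G c f) -> exists a, k = a *m G.
Proof.
rewrite mem_supp coef_sum => k0.
have /hasP[a _ /eqP<-] : has (fun a => a *m G == k) (supp B f); last by exists a.
apply: contraNT k0 => /hasPn none; rewrite big1_seq // => a /none ak.
by rewrite !coefZ coef_mon (negPf ak) !mulr0.
Qed.

(** Preimages of the basis vectors are the rows of a one-sided inverse over the integers, which
    suffices for a square matrix. *)
Lemma unitmx_of_surj (G : 'M[int]_n) : (forall k : E, exists a : E, k = a *m G) ->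
  G \in unitmx.
Proof.
move=> Gsurj; have /fin_all_exists[r rE] i := Gsurj (delta_mx 0 i).
have : (\matrix_i r i) *m G = 1%:M.
  by apply/row_matrixP => i; rewrite row_mul rowK -rE row1.
by case/mulmx1_unit.
Qed.

Lemma alg_aut_matrix (s : L -> L) : is_alg_aut s ->
  exists! p : 'M[int]_n * 'rV[K]_n,
    [/\ p.1 \in unitmx, (forall i, p.2 0 i != 0) &
        forall i, s (X (delta_mx 0 i)) = p.2 0 i *: X (\row_j p.1 j i)].
Proof.
move=> sa; have /fin_all_exists[lam] i := alg_aut_xmon (delta_mx 0 i) sa.
case/fin_all_exists => r sr.
pose A := \matrix_(j, i) r i 0 j; pose lm := \row_i lam i.
have AE i : \row_j A j i = r i by apply/rowP => j; rewrite !mxE.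
have sE i : s (X (delta_mx 0 i)) = lm 0 i *: X (\row_j A j i).
  by rewrite AE mxE; case: (sr i).
exists (A, lm); split=> /= [|[A' lm'] /= [_ _ sE']].
  have [lm0 sl] := alg_aut_laut sa sE; split=> //.
  (* Since [s] is onto, [X k] is an image, and the exponents of an image all have the form
     [a *m A^T]. *)
  rewrite -unitmx_tr; apply: unitmx_of_surj => k.
  have [_ _ _ [t _ ts]] := sa.
  apply: (@supp_laut _ (torus_char lm) (t (X k))).
  by rewrite -sl ts mem_supp coef_mon eqxx oner_neq0.
have eq i : lm 0 i = lm' 0 i /\ \row_j A j i = \row_j A' j i.
  have l0 : lm 0 i != 0 by rewrite mxE; case: (sr i).
  by apply: (mon_scale_inj (B := B) l0); rewrite -sE -sE'.
congr (_, _); last by apply/rowP => i; case: (eq i).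
by apply/matrixP => j i; case: (eq i) => _ /rowP/(_ j); rewrite !mxE.
Qed.

Lemma alg_aut_comp (s t : L -> L) (A M : 'M[int]_n) (lam mu : 'rV[K]_n) :
  is_alg_aut s -> is_alg_aut t ->
  (forall i, s (X (delta_mx 0 i)) = lam 0 i *: X (\row_j A j i)) ->
  (forall i, t (X (delta_mx 0 i)) = mu 0 i *: X (\row_j M j i)) ->
  forall i, s (t (X (delta_mx 0 i))) =
    (mu 0 i * \prod_j lam 0 j ^ M j i) *: X (\row_j (A *m M) j i).
Proof.
move=> sa _ sE tE i; have [lam0 sl] := alg_aut_laut sa sE.
rewrite tE sl linear_mapZ ?lautU; last exact: laut_linear.
rewrite scalerA /torus_char; congr (_ * _ *: X _).
  by apply: eq_bigr => j _; rewrite mxE.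
by rewrite -!delta_mulmx_tr -mulmxA -trmx_mul.
Qed.

End Automorphisms.

(** * Homogeneous components of derivations and their brackets *)

Section Derivations.
Context (K : fieldType) (n : nat) (L : comAlgType K) (B : monomial_basis n L).
Local Notation E := (expo n).
Local Notation X := (mon B).
Local Notation cf := (coef B).
Implicit Types (a b k : E) (f g : L) (h : 'rV[K]_n) (d e : L -> L).

Lemma derivation_linear d : is_derivation d -> linear_map d.
Proof. by case. Qed.

Lemma derivation_comb (c : K) d e : is_derivation d -> is_derivation e ->
  is_derivation (fun f => c *: d f + e f).
Proof.
case=> ld Ld [le Le]; split=> [c' f g|f g].
  by rewrite ld le !scalerDr !scalerA mulrC addrACA.
by rewrite Ld Le mulrDl mulrDr scalerDr -scalerAr -scalerAl addrACA.
Qed.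

Lemma derivation0 : is_derivation (fun _ : L => 0).
Proof. by split=> [c f g|f g]; rewrite ?scaler0 ?mulr0 ?mul0r addr0. Qed.

Lemma derivationZ (c : K) d : is_derivation d -> is_derivation (fun f => c *: d f).
Proof.
case=> ld Ld; split=> [c' f g|f g].
  by rewrite ld scalerDr !scalerA mulrC.
by rewrite Ld scalerDr -scalerAr -scalerAl.
Qed.

Lemma derivation_sum I (r : seq I) (D : I -> L -> L) :
  (forall i, is_derivation (D i)) -> is_derivation (fun f => \sum_(i <- r) D i f).
Proof.
move=> dD; elim: r => [|i r IHr].
  rewrite (_ : (fun _ => _) = fun=> 0); first exact: derivation0.
  by apply: functional_extensionality => f; rewrite big_nil.
rewrite (_ : (fun _ => _) = fun f => 1 *: D i f + \sum_(j <- r) D j f).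
  exact: derivation_comb.
by apply: functional_extensionality => f; rewrite big_cons scale1r.
Qed.

Definition bracket d e : L -> L := fun f => d (e f) - e (d f).

Lemma derivation_bracket d e : is_derivation d -> is_derivation e ->
  is_derivation (bracket d e).
Proof.
rewrite /bracket; case=> ld Ld [le Le]; split=> [c f g|f g].
  by rewrite !(ld, le) scalerBr opprD addrACA.
rewrite Ld Le (linear_mapD _ _ ld) (linear_mapD _ _ le) !Ld !Le; ring.
Qed.

(* [d = sum_k W k (dcoef d k)], see [derivation_expand]. *)
Definition dcoef d k : 'rV[K]_n :=
  \row_i cf (k + delta_mx 0 i) (d (X (delta_mx 0 i))).

(** By the Leibniz rule the logarithmic derivative [X (- a) * d (X a)] is additive in [a]. Each of
    its coefficients is therefore fixed by the basis vectors, where it gives the entries of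
    [dcoef]. *)
Lemma coef_derivation d a k : is_derivation d ->
  cf k (d (X a)) = dot (dcoef d (k - a)) a.
Proof.
case=> ld Ld; have -> : cf k (d (X a)) = cf (k - a) (X (- a) * d (X a)).
  by rewrite coef_monM opprK subrK.
set b := k - a; pose u a := cf b (X (- a) * d (X a)).
have uD a1 a2 : u (a1 + a2) = u a1 + u a2.
  rewrite /u monD Ld -coefD opprD monD; congr (cf b _).
  rewrite mulrDr addrC; congr (_ + _).
    rewrite -[in RHS](monNK B a2 (X (- a1) * _)); ring.
  rewrite -[in RHS](monNK B a1 (X (- a2) * _)); ring.
rewrite -/(u a) (expo_additive uD) dotE; apply: eq_bigr => i _.
by rewrite mxE /u coef_monM opprK mulrzr.
Qed.

Lemma derivation_eq d e : is_derivation d -> is_derivation e ->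
  (forall k, dcoef d k = dcoef e k) -> d = e.
Proof.
move=> dd de eq; apply: functional_extensionality.
apply: (linear_map_eq (B := B)); [exact: derivation_linear..|move=> a].
by apply: (@coef_inj _ _ _ B) => k; rewrite !coef_derivation ?eq.
Qed.

Lemma dcoef_comb (c : K) d e k :
  dcoef (fun f => c *: d f + e f) k = c *: dcoef d k + dcoef e k.
Proof. by apply/rowP => i; rewrite !mxE coef_linear. Qed.

Lemma dcoefZ (c : K) d k : dcoef (fun f => c *: d f) k = c *: dcoef d k.
Proof. by apply/rowP => i; rewrite !mxE coefZ. Qed.

Lemma dcoef_sum I (r : seq I) (D : I -> L -> L) k :
  dcoef (fun f => \sum_(i <- r) D i f) k = \sum_(i <- r) dcoef (D i) k.
Proof.
apply/rowP => i; rewrite mxE coef_sum summxE.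
by apply: eq_bigr => j _; rewrite mxE.
Qed.

Lemma dcoef0 k : dcoef (fun=> 0) k = 0.
Proof. by apply/rowP => i; rewrite !mxE coef0. Qed.

(** A nonzero entry [i] of [dcoef d k] puts [k + delta_mx 0 i] into the support of
    [d (X (delta_mx 0 i))], so the filtered list misses no exponent. *)
Definition dsupp d : seq E :=
  [seq k <- undup [seq k - delta_mx 0 i | i <- enum 'I_n,
                                          k <- supp B (d (X (delta_mx 0 i)))]
   | dcoef d k != 0].

Lemma mem_dsupp d k : (k \in dsupp d) = (dcoef d k != 0).
Proof.
rewrite mem_filter andbC mem_undup; apply: andb_idl => dk.
have [i ki] := row_neq0 dk.
apply/allpairsPdep; exists i, (k + delta_mx 0 i); split.
- by rewrite mem_enum.
- by rewrite mem_supp; move: ki; rewrite mxE.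
by rewrite addrK.
Qed.

Lemma dsupp_uniq d : uniq (dsupp d).
Proof. by rewrite filter_uniq ?undup_uniq. Qed.

(* x^a times the vector field [sum_i h_i x_i d/dx_i]. *)
Definition W a h : L -> L := linext B (fun k => dot h k *: X (a + k)).

Lemma W_mon a h k : W a h (X k) = dot h k *: X (a + k).
Proof. exact: linext_mon. Qed.

Lemma W_derivation a h : is_derivation (W a h).
Proof.
apply: (linear_map_derivation (B := B)); first exact: linext_linear.
move=> b k; rewrite !W_mon dotDr scalerDl -scalerAr -scalerAl -!monD.
by rewrite [b + (a + k)]addrCA -[a + b + k]addrA [LHS]addrC.
Qed.

Lemma coef_W a h f k : cf k (W a h f) = dot h (k - a) * cf (k - a) f.
Proof.
rewrite {2}(monE B f) /W /linext !coef_sum mulr_sumr; apply: eq_bigr => b _.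
rewrite !coefZ !coef_mon [b == _]eq_sym subr_eq (addrC b) (eq_sym k).
by have [<-|] := eqVneq; rewrite ?mulr0 // addrAC subrr add0r !mulr1 mulrC.
Qed.

Lemma dcoef_W a h k : dcoef (W a h) k = if k == a then h else 0.
Proof.
apply/rowP => i; rewrite mxE W_mon coefZ coef_mon dot_deltar.
rewrite (inj_eq (addIr _)) (eq_sym a); case: eqP => _; first by rewrite mulr1.
by rewrite mulr0 mxE.
Qed.

Lemma derivation_expand d : is_derivation d ->
  d = fun f => \sum_(a <- dsupp d) W a (dcoef d a) f.
Proof.
move=> dd; apply: derivation_eq => // [|k].
  by apply: derivation_sum => a; apply: W_derivation.
rewrite dcoef_sum; have [kd|kd] := boolP (k \in dsupp d).
  rewrite (big_rem k) //= dcoef_W eqxx big1_seq ?addr0 // => a /=.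
  rewrite mem_rem_uniq ?dsupp_uniq // => /andP[ak _].
  by rewrite dcoef_W eq_sym (negPf ak).
rewrite big1_seq => [|a /= ad]; first by move: kd; rewrite mem_dsupp negbK => /eqP.
by rewrite dcoef_W; case: eqP => // ka; rewrite ka ad in kd.
Qed.

(** Bracketing with a homogeneous field of degree [a] shifts degrees by [a], so only the component
    of [e] at [k - a] enters. *)
Lemma dcoef_bracketW a h e k : is_derivation e ->
  dcoef (bracket (W a h) e) k =
  dot h (k - a) *: dcoef e (k - a) - dot (dcoef e (k - a)) a *: h.
Proof.
move=> de; have [le _] := de; set v := dcoef e (k - a).
apply/rowP => i; pose b : E := delta_mx 0 i.
have k1 : k + b - a - b = k - a by rewrite addrAC addrK.
have k2 : k + b - (a + b) = k - a by rewrite opprD addrACA subrr addr0.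
rewrite mxE -/b /bracket coefB coef_W W_mon linear_mapZ // coefZ !coef_derivation //.
have k3 : k + b - a = k - a + b by rewrite addrAC.
rewrite k1 k2 k3 -/v !(dotDr _ _ b) !dot_deltar; clearbody v; rewrite !mxE; ring.
Qed.

Lemma bracket_WW a b h h' :
  bracket (W a h) (W b h') = W (a + b) (dot h b *: h' - dot h' a *: h).
Proof.
apply: derivation_eq => [||k].
- by apply: derivation_bracket; apply: W_derivation.
- exact: W_derivation.
rewrite dcoef_bracketW ?dcoef_W; last exact: W_derivation.
have -> : (k - a == b) = (k == a + b) by rewrite subr_eq addrC.
case: eqP => [->|_]; last by rewrite scaler0 dot0l scale0r subr0.
by rewrite addrAC subrr add0r.
Qed.

Lemma dcoef_bracket d e k : is_derivation d -> is_derivation e ->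
  dcoef (bracket d e) k =
  \sum_(a <- dsupp d) (dot (dcoef d a) (k - a) *: dcoef e (k - a) -
                       dot (dcoef e (k - a)) a *: dcoef d a).
Proof.
move=> dd de; rewrite {1}(derivation_expand dd).
have [le _] := de.
rewrite (_ : bracket _ e =
             fun f => \sum_(a <- dsupp d) bracket (W a (dcoef d a)) e f).
  by rewrite dcoef_sum; apply: eq_bigr => a _; rewrite dcoef_bracketW.
apply: functional_extensionality => f.
by rewrite /bracket linear_map_sum // sumrB.
Qed.

(** Ad-local finiteness, phrased by a polynomial in [bracket d] that kills [e] and may depend on
    [e]; a Lie automorphism carries such a relation over term by term. *)
Definition adjoint_finite d : Prop := forall e, is_derivation e ->
  exists2 p : {poly K}, p != 0 &
    forall f, \sum_(i < size p) p`_i *: iter i (bracket d) e f = 0.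

Lemma derivation_iter d e i : is_derivation d -> is_derivation e ->
  is_derivation (iter i (bracket d) e).
Proof. by move=> dd de; elim: i => //= i; apply: derivation_bracket. Qed.

Lemma dcoef_bracket_lt (l : E -> int) d e a b k : {morph l : x y / x + y} ->
  is_derivation d -> is_derivation e ->
  {in dsupp d, forall k, l k <= l a} -> (forall k, dcoef e k != 0 -> l k <= l b) ->
  dcoef (bracket d e) k != 0 -> l k <= l (a + b).
Proof.
move=> lD dd de da eb; rewrite dcoef_bracket //; apply: contraR.
rewrite -ltNge => lt.
rewrite big1_seq // => c /= cd.
suff -> : dcoef e (k - c) = 0 by rewrite scaler0 dot0l scale0r subr0.
apply/eqP; apply: contraTT lt => /eb; rewrite -(lerD2r (l c)) -lD subrK => kc.
by rewrite -leNgt (le_trans kc) // lD addrC lerD2r da.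
Qed.

(** For [c] in [dsupp d] other than [a], the exponent [a + b - c] lies above [l b], where [e] has no
    component; only the term of [a] survives. *)
Lemma dcoef_bracket_top (l : E -> int) d e a b : {morph l : x y / x + y} ->
  is_derivation d -> is_derivation e -> a \in dsupp d ->
  {in dsupp d, forall k, k != a -> l k < l a} ->
  (forall k, dcoef e k != 0 -> l k <= l b) ->
  dcoef (bracket d e) (a + b) =
  dot (dcoef d a) b *: dcoef e b - dot (dcoef e b) a *: dcoef d a.
Proof.
move=> lD dd de ad da eb; rewrite dcoef_bracket // (big_rem a) //=.
rewrite [V in _ + V]big1_seq ?addr0 => [|c /=]; first by rewrite addrAC subrr add0r.
rewrite mem_rem_uniq ?dsupp_uniq // => /andP[ca cd].
suff -> : dcoef e (a + b - c) = 0 by rewrite scaler0 dot0l scale0r subr0.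
apply/eqP; apply: contraTT (da c cd ca) => /eb.
by rewrite -(lerD2r (l c)) -lD subrK lD addrC lerD2l -leNgt.
Qed.

End Derivations.

(** * Ad-locally finite derivations in characteristic zero *)

Section AdjointFinite.
Context (K : fieldType) (n : nat) (L : comAlgType K) (B : monomial_basis n L).
Context (char0 : [pchar K] =i pred0).
Local Notation E := (expo n).
Local Notation X := (mon B).
Local Notation cf := (coef B).
Local Notation W := (W B).
Local Notation dcoef := (dcoef B).
Local Notation dsupp := (dsupp B).
Implicit Types (a b k : E) (f g : L) (h : 'rV[K]_n) (d e : L -> L).

Lemma char0_natr_eq0 m : (m%:R == 0 :> K) = (m == 0)%N.
Proof. by move/pcharf0P: char0 => ->. Qed.

Lemma char0_intr_eq0 (z : int) : (z%:~R == 0 :> K) = (z == 0).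
Proof. by case: z => m; rewrite ?NegzE ?mulrNz ?oppr_eq0 -?pmulrn char0_natr_eq0. Qed.

Lemma dot_inj a b : (forall h, dot h a = dot h b) -> a = b.
Proof.
move=> ab; apply/rowP => i; apply/eqP; rewrite -subr_eq0 -char0_intr_eq0 rmorphB /=.
by rewrite -!dot_deltal ab subrr.
Qed.

Lemma bracket_W0 h d : is_derivation d ->
  forall k, dcoef (bracket (W 0 h) d) k = dot h k *: dcoef d k.
Proof. by move=> dd k; rewrite dcoef_bracketW // subr0 dot0r scale0r subr0. Qed.

(** [bracket (W 0 h)] is diagonal with eigenvalue [dot h k] in degree [k], so the polynomial whose
    roots are the finitely many eigenvalues on [dsupp e] kills [e]. *)
Lemma W0_adjoint_finite h : adjoint_finite (W 0 h).
Proof.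
move=> e de; pose r := [seq dot h a | a <- dsupp e].
pose p := \prod_(c <- r) ('X - c%:P); exists p.
  by rewrite monic_neq0 ?monic_prod_XsubC.
have iterE i k : dcoef (iter i (bracket (W 0 h)) e) k = dot h k ^+ i *: dcoef e k.
  elim: i => [|i IHi] /=; first by rewrite expr0 scale1r.
  rewrite bracket_W0 ?IHi ?scalerA ?exprS //.
  by apply: derivation_iter => //; apply: W_derivation.
pose D (i : 'I_(size p)) f := p`_i *: iter i (bracket (W 0 h)) e f.
suff D0 : (fun f => \sum_i D i f) = fun=> 0.
  by move=> f; have := congr1 (fun F => F f) D0.
have dD : is_derivation (fun f => \sum_i D i f).
  apply: derivation_sum => i; apply: derivationZ.
  by apply: derivation_iter => //; apply: W_derivation.
apply: (derivation_eq (B := B)) => // [|k]; first exact: derivation0.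
rewrite dcoef0 dcoef_sum; transitivity (p.[dot h k] *: dcoef e k).
  rewrite horner_coef scaler_suml; apply: eq_bigr => i _.
  by rewrite -scalerA -iterE dcoefZ.
have [ke|] := boolP (k \in dsupp e); last first.
  by rewrite mem_dsupp negbK => /eqP->; rewrite scaler0.
have /rootP-> : root p (dot h k) by rewrite root_prod_XsubC map_f.
by rewrite scale0r.
Qed.

(** The scalar is the factor that the leading coefficient picks up at the [m]-th application of
    [bracket d] in the next proof, counting from 0. *)
Lemma nonresonant_exponent a h : a != 0 -> h != 0 ->
  exists b, forall m, dot h (b + a *+ m) - dot h a != 0.
Proof.
move=> a0 h0; have [ha|ha] := eqVneq (dot h a) 0.
  have [i hi] := row_neq0 h0.
  by exists (delta_mx 0 i) => m; rewrite dotDr dotMnr ha mul0rn addr0 subr0 dot_deltar.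
(* With [b = 2 a] the scalar is [m + 1] times [dot h a]. *)
exists (a *+ 2) => m; rewrite -mulrnDr dotMnr -{2}[dot h a]mulr1n -mulrnBr //.
by rewrite -mulr_natr mulf_neq0 // char0_natr_eq0.
Qed.

(* On [W b h] with [h] the extremal coefficient of [d], the leading term of
   the [m]-th iterate of [ad d] moves by [m] times the extremal exponent and
   never vanishes; the iterates are therefore linearly independent. *)
Lemma adjoint_finite_W0 d : is_derivation d -> adjoint_finite d ->
  exists h, d = W 0 h.
Proof.
move=> dd fin; have [d0|] := boolP (all (pred1 0) (dsupp d)).
  exists (dcoef d 0); apply: (derivation_eq (B := B)) => // [|k].
    exact: W_derivation.
  rewrite dcoef_W; case: eqP => [->//|/eqP k0].
  apply/eqP; apply: contraNT k0 => dk.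
  by apply: (allP d0 k); rewrite mem_dsupp.
case/allPn => c cd /= c0; exfalso.
have [l [lD linj lc]] : exists l : E -> int,
    [/\ {morph l : x y / x + y}, {in dsupp d &, injective l} & 0 < l c].
  (* Listing 0 among the exponents makes [l c] nonzero; if it is negative, [l] is replaced by its
     opposite. *)
  have [l lD linj] := additive_inj_on (0 :: dsupp d).
  have l0 : l 0 = 0 by apply: (addrI (l 0)); rewrite -lD !addr0.
  have lc0 : l c != 0.
    apply: contra_neq c0; rewrite -{1}l0; apply: linj; rewrite ?mem_head //.
    by rewrite in_cons cd orbT.
  have linj' : {in dsupp d &, injective l}.
    by move=> x y xd yd; apply: linj; rewrite in_cons ?xd ?yd orbT.
  have [lc|lc|] := ltgtP 0 (l c); last by move=> /eqP; rewrite eq_sym (negPf lc0).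
    by exists l.
  exists (fun k => - l k); split; last by rewrite oppr_gt0.
    by move=> x y; rewrite lD opprD.
  by move=> x y xd yd /oppr_inj; apply: linj'.
have ne : dsupp d != [::] by case: (dsupp d) cd.
have [a ad amax] := seq_argmax l ne.
have la : 0 < l a by apply: lt_le_trans lc (amax _ cd).
have l0 : l 0 = 0 by apply: (addrI (l 0)); rewrite -lD !addr0.
have a0 : a != 0 by apply: contraTneq la => ->; rewrite l0 ltxx.
set h := dcoef d a; have h0 : h != 0 by rewrite -mem_dsupp.
have [b bh] := nonresonant_exponent a0 h0.
have amax' : {in dsupp d, forall k, k != a -> l k < l a}.
  move=> k kd ka; rewrite lt_neqAle amax // andbT.
  by apply: contra_neq ka; apply: linj.
pose e m := iter m (bracket d) (W b h).
have de m : is_derivation (e m) by apply: derivation_iter => //; apply: W_derivation.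
have top m : (forall k, dcoef (e m) k != 0 -> l k <= l (b + a *+ m)) /\
             exists2 c, c != 0 & dcoef (e m) (b + a *+ m) = c *: h.
  elim: m => [|m [IHl [v v0 IHv]]].
    split=> [k|]; last first.
      by exists 1; rewrite ?oner_neq0 // mulr0n addr0 dcoef_W eqxx scale1r.
    by rewrite dcoef_W mulr0n addr0; have [->|_] := eqVneq k b; rewrite ?lexx ?eqxx.
  rewrite mulrS addrCA; split=> [k|]; first by apply: dcoef_bracket_lt.
  exists ((dot h (b + a *+ m) - dot h a) * v); first by rewrite mulf_neq0.
  rewrite [e _]/= -/(e m) (dcoef_bracket_top (l := l)) // -/h IHv dotZl.
  by rewrite scalerA -scalerBl; congr (_ *: _); ring.
have [p p0 pe] := fin _ (W_derivation B b h).
have sp : (size p = (size p).-1.+1)%N by rewrite prednK // lt0n size_poly_eq0.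
set m := (size p).-1; have [v v0 ev] := (top m).2.
(* Among the iterates up to the degree [m] of [p], only the last reaches [b + a *+ m], so the
   vanishing of this coefficient contradicts that of [p] being nonzero at the top. *)
have : dcoef (fun f => \sum_(i < size p) p`_i *: e i f) (b + a *+ m) = 0.
  rewrite (_ : (fun _ => _) = fun=> 0) ?dcoef0 //.
  by apply: functional_extensionality => f; apply: pe.
rewrite (@dcoef_sum K n L B _ _ (fun (i : 'I_(size p)) f => p`_i *: e i f)).
under eq_bigr => i _ do rewrite dcoefZ.
rewrite -(big_mkord xpredT (fun i => p`_i *: dcoef (e i) (b + a *+ m))) sp.
rewrite big_nat_recr //= -/m big_nat big1 ?add0r => [/eqP|i im].
  rewrite ev !scaler_eq0 (negPf v0) (negPf h0) !orbF.
  by rewrite -[p`_m]/(lead_coef p) lead_coef_eq0 (negPf p0).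
suff -> : dcoef (e i) (b + a *+ m) = 0 by rewrite scaler0.
apply/eqP; apply: contraT => /((top i).1); rewrite !lD lerD2l.
have lM j : l (a *+ j) = l a *+ j.
  by elim: j => [|j IHj]; rewrite ?mulr0n // !mulrS lD IHj.
by rewrite !lM ler_pMn2l // leqNgt; case/andP: im => _ ->.
Qed.

End AdjointFinite.

(** * Rigidity of bracket-compatible families of linear maps *)

Section TwistedBracket.
Context (K : fieldType) (n : nat) (n_gt0 : (0 < n)%N) (char0 : [pchar K] =i pred0).
Local Notation E := (expo n).
(* Once its action on the weight lattice is undone, a Lie automorphism sends
   [W a h] to [W a (U a h)]; [U_bracket] is then the compatibility with brackets. *)
Context (U : E -> 'rV[K]_n -> 'rV[K]_n).
Context (U_linear : forall a (c : K) h h', U a (c *: h + h') = c *: U a h + U a h').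
Context (U_inj : forall a h, U a h = 0 -> h = 0).
Context (U_0 : forall h, U 0 h = h).
Context (U_bracket : forall a b h h',
  U (a + b) (dot h b *: h' - dot h' a *: h) =
  dot (U a h) b *: U b h' - dot (U b h') a *: U a h).
Implicit Types (a b : E) (h : 'rV[K]_n).

Local Notation ei i := (delta_mx 0 i : 'rV[K]_n).

Lemma twist0 a : U a 0 = 0.
Proof. by have := U_linear a (-1) 0 0; rewrite scaler0 addr0 scaleN1r addNr. Qed.

(** The two orthogonality relations make the left side of [U_bracket] zero, so [U b h'] and [U a h]
    satisfy a linear relation. If its coefficients are nonzero, pairing it with [a] gives the second
    branch. *)
Lemma twist_orthogonal_or a b h h' : h' != 0 -> dot h' a = 0 -> dot h b = 0 ->
  dot (U a h) b = 0 \/ dot (U a h) b = dot (U a h) a.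
Proof.
move=> h'0 h'a hb; set x := dot (U a h) b; set y := dot (U b h') a.
have [->|x0] := eqVneq x 0; [by left|right].
have /eqP : x *: U b h' - y *: U a h = 0.
  by rewrite -U_bracket hb h'a !scale0r subr0 twist0.
rewrite subr_eq0 => /eqP xy.
have y0 : y != 0.
  apply: contra_neq h'0 => y0; apply: (U_inj (a := b)); apply/eqP.
  by have /eqP := xy; rewrite y0 scale0r scaler_eq0 (negPf x0).
apply: (mulfI y0); rewrite -[RHS]dotZl -xy dotZl; apply: mulrC.
Qed.

Lemma orthogonal_exists a (i j : 'I_n) : 
  i != j -> exists2 h : 'rV[K]_n, h != 0 & dot h a = 0.
Proof.
move=> ij; have eN (k : 'I_n) : ei k != 0.
  by apply/eqP => /rowP/(_ k)/eqP; rewrite !mxE !eqxx oner_eq0.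
have [ai|ai] := eqVneq (a 0 i) 0; first by exists (ei i); rewrite // dot_deltal ai.
exists ((a 0 j)%:~R *: ei i - (a 0 i)%:~R *: ei j).
  apply/eqP => /rowP/(_ j)/eqP; rewrite !mxE !eqxx [j == i]eq_sym (negPf ij) /=.
  by rewrite mulr0 mulr1 sub0r oppr_eq0 char0_intr_eq0 // (negPf ai).
by rewrite -scaleNr dotDl !dotZl !dot_deltal mulNr mulrC subrr.
Qed.

(* The dichotomy for both [b] and [2 b] leaves only its first branch. *)
Lemma twist_orthogonal a b h : dot h b = 0 -> dot (U a h) b = 0.
Proof.
move=> hb; case: (pickP [pred p : 'I_n * 'I_n | p.1 != p.2]) => [[i j] /= ij|same].
  have [h' h'0 h'a] := orthogonal_exists a ij.
  have [//|xb] := twist_orthogonal_or h'0 h'a hb.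
  have hb2 : dot h (b + b) = 0 by rewrite dotDr hb addr0.
  have := twist_orthogonal_or h'0 h'a hb2; rewrite dotDr -xb.
  case=> [/eqP|/eqP]; last by rewrite -subr_eq0 addrK => /eqP.
  by rewrite -mulr2n -mulr_natr mulf_eq0 (char0_natr_eq0 char0) orbF => /eqP.
(* For [n = 1] the auxiliary [h'] may not exist, but then [dot h b] is a product of two coordinates,
   one of which vanishes. *)
pose i0 : 'I_n := Ordinal n_gt0.
have all0 (i : 'I_n) : i = i0 by apply/eqP; have := same (i, i0) => /= /negbFE.
have hE : h = h 0 i0 *: ei i0.
  by apply/rowP => i; rewrite (all0 i) !mxE !eqxx mulr1.
move: hb; rewrite {1}hE dotZl dot_deltal => /eqP; rewrite mulf_eq0 => /orP[/eqP h0|].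
  by rewrite hE h0 scale0r twist0 dot0l.
rewrite char0_intr_eq0 // => /eqP b0; have -> : b = 0; last by rewrite dot0r.
by apply/rowP => i; rewrite (all0 i) b0 mxE.
Qed.

(** Orthogonality to the basis vectors makes [U a] diagonal; orthogonality of [e_i + e_j] to
    [e_i - e_j] makes its diagonal entries equal. *)
Lemma twist_scalar : exists c : E -> K, forall a h, U a h = c a *: h.
Proof.
pose i0 : 'I_n := Ordinal n_gt0.
pose u a i := U a (ei i) 0 i.
have diag a h j : U a h 0 j = h 0 j * u a j.
  have /(twist_orthogonal a) : dot (- h 0 j *: ei j + h) (delta_mx 0 j) = 0.
    by rewrite dotDl dotZl !dot_deltar mxE !eqxx mulr1 addNr.
  rewrite U_linear dotDl dotZl !dot_deltar mulNr addrC => /eqP.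
  by rewrite subr_eq0 => /eqP.
have same a i j : u a i = u a j.
  have [->//|ij] := eqVneq i j.
  have /(twist_orthogonal a) : dot (ei i + ei j) (delta_mx 0 i - delta_mx 0 j) = 0.
    rewrite dotBr !dot_deltar !mxE !eqxx [j == i]eq_sym (negPf ij) addr0 add0r.
    by rewrite subrr.
  rewrite dotBr !dot_deltar !diag !mxE !eqxx [j == i]eq_sym (negPf ij) addr0 add0r.
  by rewrite !mul1r => /eqP; rewrite subr_eq0 => /eqP.
exists (fun a => u a i0) => a h; apply/rowP => j.
by rewrite diag mxE mulrC (same a j i0).
Qed.

(* The bracket only gives [c (a + b) = c a * c b] for [a != b]; the case
   [a = b] follows from [4 a = a + 3 a] and [2 a = 4 a + (- 2 a)]. *)
Lemma twist_char : exists2 c : E -> K, expo_char c & forall a h, U a h = c a *: h.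
Proof.
have [c Uc] := twist_scalar; exists c => //.
pose i0 : 'I_n := Ordinal n_gt0.
have eN (k : 'I_n) : ei k != 0.
  by apply/eqP => /rowP/(_ k)/eqP; rewrite !mxE !eqxx oner_eq0.
have c1 : c 0 = 1.
  have := U_0 (ei i0); rewrite Uc => /rowP/(_ i0).
  by rewrite !mxE !eqxx mulr1.
have c0 a : c a != 0.
  apply: contra_neq (eN i0) => ca; apply: (U_inj (a := a)).
  by rewrite Uc ca scale0r.
have cD a b : a != b -> c (a + b) = c a * c b.
  move=> ab; have [i abi] : exists i, b 0 i != a 0 i.
    have [|i] := @row_neq0 _ _ (b - a); first by rewrite subr_eq0 eq_sym.
    by rewrite !mxE subr_eq0 => abi; exists i.
  (* Both sides are multiples of [ei i] with the common factor [b_i - a_i], which is nonzero by the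
     choice of [i]. *)
  have := U_bracket a b (ei i) (ei i); rewrite !Uc !dotZl !dot_deltal.
  rewrite -scalerBl !scalerA -scalerBl => /rowP/(_ i); rewrite !mxE !eqxx !mulr1.
  have ba : (b 0 i)%:~R - (a 0 i)%:~R != 0 :> K.
    by rewrite -rmorphB char0_intr_eq0 //= subr_eq0.
  move=> e; apply: (mulIf ba); rewrite e; ring.
split=> // a b; have [<-|] := eqVneq a b; last exact: cD.
have [->|a0] := eqVneq a 0; first by rewrite addr0 c1 mulr1.
have [i ai] := row_neq0 a0.
have neq3 : a != a *+ 3.
  by apply/eqP => /rowP/(_ i); rewrite ?mulrS mulr0n !mxE;
    move: (a 0 i) ai => z; lia.
have neq2 : a != a *+ 2.
  by apply/eqP => /rowP/(_ i); rewrite ?mulrS mulr0n !mxE;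
    move: (a 0 i) ai => z; lia.
have neq42 : a *+ 4 != - (a *+ 2).
  by apply/eqP => /rowP/(_ i); rewrite ?mulrS mulr0n !mxE;
    move: (a 0 i) ai => z; lia.
have neq22 : a *+ 2 != - (a *+ 2).
  by apply/eqP => /rowP/(_ i); rewrite ?mulrS mulr0n !mxE;
    move: (a 0 i) ai => z; lia.
have e4 : c (a *+ 4) = c a * (c a * c (a *+ 2)) by rewrite mulrS cD // mulrS cD.
have e2 : c (a *+ 2) = c (a *+ 4) * c (- (a *+ 2)).
  by rewrite -cD // -mulrnBr.
have e0 : c (a *+ 2) * c (- (a *+ 2)) = 1 by rewrite -cD // subrr c1.
rewrite -mulr2n; apply: (mulfI (c0 (- (a *+ 2)))).
rewrite mulrC e0 -[LHS](mulfV (c0 (a *+ 2))) {1}e2 e4.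
apply: (mulIf (c0 (a *+ 2))); rewrite mulfVK //; ring.
Qed.

End TwistedBracket.

(** * Lie automorphisms are conjugations *)

Section LieAutomorphisms.
Context (K : fieldType) (n : nat) (L : comAlgType K) (B : monomial_basis n L).
Local Notation E := (expo n).
Local Notation X := (mon B).
Local Notation cf := (coef B).
Local Notation W := (W B).
Local Notation dcoef := (dcoef B).
Local Notation dsupp := (dsupp B).
Implicit Types (a b k : E) (f g : L) (h : 'rV[K]_n) (d e : L -> L).

(** [phi] is defined on all functions, so each clause is restricted to derivations, and bijectivity
    becomes a unique preimage among them. *)
Definition is_lie_aut (phi : (L -> L) -> (L -> L)) : Prop :=
  [/\ (forall d, is_derivation d -> is_derivation (phi d)),
      (forall (c : K) d e, is_derivation d -> is_derivation e ->
          phi (fun f => c *: d f + e f) = (fun f => c *: phi d f + phi e f)),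
      (forall d e, is_derivation d -> is_derivation e ->
          phi (bracket d e) = bracket (phi d) (phi e))
    & (forall e, is_derivation e -> exists! d, is_derivation d /\ phi d = e)].

Lemma conj_derivation (s t : L -> L) d : is_alg_aut s -> cancel s t -> cancel t s ->
  is_derivation d -> is_derivation (fun f => s (d (t f))).
Proof.
move=> [ls sM _ _] st ts [ld Ld].
have lt c f g : t (c *: f + g) = c *: t f + t g.
  by apply: (can_inj st); rewrite ls !ts.
have tM f g : t (f * g) = t f * t g by apply: (can_inj st); rewrite sM !ts.
split=> [c f g|f g]; first by rewrite lt ld ls.
by rewrite tM Ld (linear_mapD _ _ ls) !sM !ts.
Qed.

Lemma alg_aut_inv (s t : L -> L) : is_alg_aut s -> cancel s t -> cancel t s ->
  is_alg_aut t.
Proof.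
move=> [ls sM s1 _] st ts; split; last by exists s.
- by move=> c f g; apply: (can_inj st); rewrite ls !ts.
- by move=> f g; apply: (can_inj st); rewrite sM !ts.
by apply: (can_inj st); rewrite ts s1.
Qed.

Lemma alg_aut_lie_aut (s : L -> L) : is_alg_aut s ->
  exists phi, is_lie_aut phi /\
    forall d, is_derivation d -> forall f, phi d (s f) = s (d f).
Proof.
move=> sa; have [ls sM s1 [t st ts]] := sa; have ta := alg_aut_inv sa st ts.
exists (fun d f => s (d (t f))); split=> [|d _ f]; last by rewrite st.
split=> [d|c d e _ _|d e _ _|e de]; first exact: conj_derivation.
- by apply: functional_extensionality => f; rewrite ls.
- apply: functional_extensionality => f; rewrite /bracket !st.
  by rewrite -!scaleN1r addrC ls addrC.
exists (fun f => t (e (s f))); split=> [|d [dd <-]].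
  split; first exact: conj_derivation ta ts st de.
  by apply: functional_extensionality => f; rewrite !ts.
by apply: functional_extensionality => f; rewrite !st.
Qed.

(** Commuting with the [W 0 h] makes each [X a] an eigenvector of [tau]. Commuting with a
    [W (- a) h] that sends [X a] to a nonzero constant makes the eigenvalue 1. *)
Lemma commuting_id (char0 : [pchar K] =i pred0) (tau : L -> L) : linear_map tau ->
  tau 1 = 1 ->
  (forall d, is_derivation d -> forall f, tau (d f) = d (tau f)) -> tau =1 id.
Proof.
move=> lt t1 comm; apply: (linear_map_eq (B := B)) => // a.
have comW b h f : tau (W b h f) = W b h (tau f) by apply/comm/W_derivation.
have eig : tau (X a) = cf a (tau (X a)) *: X a.
  apply: (@coef_inj _ _ _ B) => k; rewrite coefZ coef_mon.
  have [<-|ak] := eqVneq a k; first by rewrite mulr1.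
  rewrite mulr0; apply/eqP; apply: contraT => tk.
  case/eqP: ak; apply: (dot_inj char0) => h; apply: (mulIf tk).
  have := congr1 (cf k) (comW 0 h (X a)).
  by rewrite W_mon add0r linear_mapZ // coefZ coef_W subr0.
have [->|a0] := eqVneq a 0; first by rewrite mon0.
have [i ai] := row_neq0 a0; pose h : 'rV[K]_n := delta_mx 0 i.
have ha : dot h a != 0 by rewrite dot_deltal char0_intr_eq0.
have [lW _] := W_derivation B (- a) h.
have := comW (- a) h (X a); rewrite W_mon addNr mon0 linear_mapZ // t1 eig.
rewrite linear_mapZ // W_mon addNr mon0 -{1}[dot h a]mul1r -scalerA => /esym/eqP.
rewrite -subr_eq0 -scalerBl !scaler_eq0 (negPf ha) oner_eq0 orbF /= orbF subr_eq0.
by move=> /eqP->; rewrite scale1r.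
Qed.

Lemma W_comb a (c : K) h h' :
  W a (c *: h + h') = fun f => c *: W a h f + W a h' f.
Proof.
apply: (derivation_eq (B := B)) => [||k]; first exact: W_derivation.
  by apply: derivation_comb; apply: W_derivation.
by rewrite dcoef_comb !dcoef_W; case: eqP => // _; rewrite scaler0 addr0.
Qed.

Lemma W0h a : W a 0 = fun=> 0.
Proof.
apply: (derivation_eq (B := B)) => [||k]; [exact: W_derivation|exact: derivation0|].
by rewrite dcoef_W dcoef0 if_same.
Qed.

Lemma W_eq0 a h : W a h = (fun=> 0) -> h = 0.
Proof.
by move=> Wh; have := dcoef_W B a h a; rewrite eqxx Wh dcoef0.
Qed.

Section OneAutomorphism.
Context (char0 : [pchar K] =i pred0) (n_gt0 : (0 < n)%N).
Context (phi : (L -> L) -> (L -> L)) (phi_aut : is_lie_aut phi).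

Lemma lie_aut_derivation d : is_derivation d -> is_derivation (phi d).
Proof. by case: phi_aut => + _ _ _; apply. Qed.

Lemma lie_aut_comb (c : K) d e : is_derivation d -> is_derivation e ->
  phi (fun f => c *: d f + e f) = (fun f => c *: phi d f + phi e f).
Proof. by case: phi_aut => _ + _ _; apply. Qed.

Lemma lie_aut_bracket d e : is_derivation d -> is_derivation e ->
  phi (bracket d e) = bracket (phi d) (phi e).
Proof. by case: phi_aut => _ _ + _; apply. Qed.

Lemma lie_aut_surj e : is_derivation e -> exists2 d, is_derivation d & phi d = e.
Proof. by case: phi_aut => _ _ _ /[apply] -[d [[dd <-] _]]; exists d. Qed.

Lemma lie_aut_inj d e : is_derivation d -> is_derivation e -> phi d = phi e -> d = e.
Proof.
move=> dd de eq; case: phi_aut => _ _ _ /(_ _ (lie_aut_derivation de))[d' [_ uniq]].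
by rewrite -(uniq d) // -(uniq e).
Qed.

Lemma lie_aut0 : phi (fun=> 0) = fun=> 0.
Proof.
have d0 := @derivation0 K L.
have := lie_aut_comb (-1) d0 d0.
rewrite (_ : (fun f => -1 *: 0 + 0) = (fun=> 0 : L)).
  move=> ->; apply: functional_extensionality => f.
  by rewrite scaleN1r addNr.
by apply: functional_extensionality => f; rewrite scaler0 addr0.
Qed.

Lemma lie_aut_sum I (r : seq I) (c : I -> K) (D : I -> L -> L) :
  (forall i, is_derivation (D i)) ->
  phi (fun f => \sum_(i <- r) c i *: D i f) =
  fun f => \sum_(i <- r) c i *: phi (D i) f.
Proof.
move=> dD; elim: r => [|i r IHr].
  rewrite (_ : (fun _ => _) = fun=> 0); last first.
    by apply: functional_extensionality => f; rewrite big_nil.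
  by rewrite lie_aut0; apply: functional_extensionality => f; rewrite big_nil.
rewrite (_ : (fun _ => _) =
             fun f => c i *: D i f + \sum_(j <- r) c j *: D j f); last first.
  by apply: functional_extensionality => f; rewrite big_cons.
rewrite lie_aut_comb // ?IHr.
  by apply: functional_extensionality => f; rewrite big_cons.
by apply: derivation_sum => j; apply: derivationZ.
Qed.

Lemma lie_aut_expand d : is_derivation d ->
  phi d = fun f => \sum_(a <- dsupp d) phi (W a (dcoef d a)) f.
Proof.
move=> dd; rewrite {1}(derivation_expand B dd).
have := lie_aut_sum (dsupp d) (fun=> 1) (fun a => W_derivation B a (dcoef d a)).
rewrite (_ : (fun _ => _) = fun f => \sum_(a <- dsupp d) W a (dcoef d a) f).
  move=> ->; apply: functional_extensionality => f.
  by apply: eq_bigr => a _; rewrite scale1r.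
by apply: functional_extensionality => f; apply: eq_bigr => a _; rewrite scale1r.
Qed.

Lemma lie_aut_adjoint_finite d : is_derivation d -> adjoint_finite d ->
  adjoint_finite (phi d).
Proof.
move=> dd fin _ /lie_aut_surj[e de <-]; have [p p0 pe] := fin e de.
exists p => // f.
have iterE i : iter i (bracket (phi d)) (phi e) = phi (iter i (bracket d) e).
  elim: i => //= i ->; rewrite lie_aut_bracket //; exact: derivation_iter.
have := @lie_aut_sum _ (index_enum _) (fun i : 'I_(size p) => p`_i)
  (fun i => iter i (bracket d) e) (fun i => derivation_iter i dd de).
rewrite (_ : (fun _ => _) = fun=> 0); last exact: functional_extensionality pe.
rewrite lie_aut0 => /(congr1 (fun F => F f)) /= eq0; rewrite [RHS]eq0.
by apply: eq_bigr => i _; rewrite iterE.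
Qed.

Let P h := dcoef (phi (W 0 h)) 0.

(** Ad-local finiteness is preserved by [phi] and singles out the [W 0 h], so the single coefficient
    [P h] determines the image. *)
Lemma lie_aut_W0 h : phi (W 0 h) = W 0 (P h).
Proof.
have [h' E1] := adjoint_finite_W0 B char0 (lie_aut_derivation (W_derivation B 0 h))
  (lie_aut_adjoint_finite (W_derivation B 0 h) (W0_adjoint_finite B h)).
by rewrite /P E1 dcoef_W eqxx.
Qed.

(** [W a h] has weight [dot h' a] under [W 0 h'], and applying [phi] keeps the weight; the component
    of the image at [k] has weight [dot (P h') k]. *)
Lemma lie_aut_weight a h k : dcoef (phi (W a h)) k != 0 ->
  forall h', dot (P h') k = dot h' a.
Proof.
move=> v0 h'; have dW := W_derivation B; have dphi := lie_aut_derivation (dW a h).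
have : bracket (W 0 h') (W a h) = fun f => dot h' a *: W a h f + 0.
  rewrite bracket_WW add0r dot0r scale0r subr0 -[_ *: h]addr0 W_comb.
  by rewrite W0h.
move=> /(congr1 phi); rewrite lie_aut_bracket // lie_aut_comb //; last first.
  exact: derivation0.
rewrite lie_aut0 lie_aut_W0 => /(congr1 (fun F => dcoef F k)).
rewrite bracket_W0 // dcoef_comb dcoef0 addr0 => /eqP.
by rewrite -subr_eq0 -scalerBl scaler_eq0 (negPf v0) orbF subr_eq0 => /eqP.
Qed.

Lemma lie_aut_W_neq0 a h : h != 0 -> exists k, dcoef (phi (W a h)) k != 0.
Proof.
move=> h0; set d := phi (W a h).
have [no|/allPn[k]] := boolP (all (fun k => dcoef d k == 0) (dsupp d)).
  case/eqP: h0; apply: (W_eq0 (a := a)); apply: lie_aut_inj.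
  - exact: W_derivation.
  - exact: derivation0.
  have dd : is_derivation d by apply: lie_aut_derivation; apply: W_derivation.
  rewrite -/d lie_aut0 (derivation_expand B dd).
  apply: functional_extensionality => f; rewrite big1_seq // => k /=.
  by move=> /(allP no)/eqP->; rewrite W0h.
by exists k.
Qed.

Lemma lie_aut_lattice : exists G : 'M[int]_n,
  [/\ (forall h a, dot (P h) (a *m G) = dot h a),
      (map_mx intr G)^T \in @unitmx K n &
      forall a h k, dcoef (phi (W a h)) k != 0 -> k = a *m G].
Proof.
pose h0 : 'rV[K]_n := delta_mx 0 (Ordinal n_gt0).
have h00 : h0 != 0.
  by apply/eqP => /rowP/(_ (Ordinal n_gt0))/eqP; rewrite !mxE !eqxx oner_eq0.
(* Row [i] of [G] will be any exponent occurring in the image of a nonzero field of degree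
   [delta_mx 0 i]. *)
have row_ex (i : 'I_n) : exists k : E, forall h, dot (P h) k = dot h (delta_mx 0 i).
  have [k /lie_aut_weight kP] := lie_aut_W_neq0 (delta_mx 0 i) h00.
  by exists k.
have /fin_all_exists[r rP] := row_ex.
pose G : 'M[int]_n := \matrix_i r i; exists G.
have PG h a : dot (P h) (a *m G) = dot h a.
  have u1 x y : dot (P h) ((x + y) *m G) = dot (P h) (x *m G) + dot (P h) (y *m G).
    by rewrite mulmxDl dotDr.
  have u2 (x y : E) : dot h (x + y) = dot h x + dot h y by exact: dotDr.
  rewrite (expo_additive (u := fun x => dot (P h) (x *m G)) u1) (expo_additive u2).
  by apply: eq_bigr => i _; rewrite -rowE rowK rP.
pose Q := (map_mx intr G)^T : 'M[K]_n.
(* [Q] undoes [P], so it is invertible over [K] and [P] is onto; weights against all [P h'] then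
   determine the exponent. Invertibility of [G] over the integers is obtained later. *)
have PQ h' : P h' *m Q = h'.
  by apply/rowP => i; rewrite -!dot_deltar -dot_mulmxr PG.
have [_ Qu] : (\matrix_i P (delta_mx 0 i)) \in unitmx /\ Q \in unitmx.
  by apply: mulmx1_unit; apply/row_matrixP => i; rewrite row_mul rowK PQ row1.
split=> // a h k /lie_aut_weight kP.
apply: (dot_inj char0) => h'; have -> : h' = P (h' *m Q).
  by rewrite -[LHS](mulmxK Qu) -[RHS](mulmxK Qu) PQ.
by rewrite kP PG.
Qed.

Lemma lie_aut_conj : exists s, is_alg_aut s /\
  forall d, is_derivation d -> forall f, phi d (s f) = s (d f).
Proof.
have [G [PG Qu supG]] := lie_aut_lattice.
have dW := W_derivation B; have dphi a h := lie_aut_derivation (dW a h).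
pose T a h := dcoef (phi (W a h)) (a *m G).
have phiW a h : phi (W a h) = W (a *m G) (T a h).
  apply: (derivation_eq (B := B)) => // k; rewrite dcoef_W.
  by case: eqP => [->//|kG]; apply/eqP; apply: contraT => /supG.
(* Multiplication by [Q] turns pairings with [b *m G] into pairings with [b], which brings [T] into
   the form required by [twist_char]. *)
pose Q := (map_mx intr G)^T : 'M[K]_n; pose U a h := T a h *m Q.
have T_inj a h : T a h = 0 -> h = 0.
  move=> T0; apply: (W_eq0 (a := a)); apply: lie_aut_inj => //.
    exact: derivation0.
  by rewrite lie_aut0 phiW T0 W0h.
have T_lin a c h h' : T a (c *: h + h') = c *: T a h + T a h'.
  by rewrite /T W_comb lie_aut_comb // dcoef_comb.
have T0 h : T 0 h = P h by rewrite /T mul0mx.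
have PQ h : P h *m Q = h by apply/rowP => i; rewrite -!dot_deltar -dot_mulmxr PG.
have T_bracket a b h h' : T (a + b) (dot h b *: h' - dot h' a *: h) =
    dot (T a h) (b *m G) *: T b h' - dot (T b h') (a *m G) *: T a h.
  rewrite [LHS]/T -bracket_WW lie_aut_bracket // !phiW bracket_WW mulmxDl.
  by rewrite dcoef_W eqxx.
have [||||c cc Uc] := @twist_char K n n_gt0 char0 U.
- by move=> a c h h'; rewrite /U T_lin mulmxDl scalemxAl.
- move=> a h Uh; apply: (T_inj a); rewrite -[LHS](mulmxK Qu) -/(U a h) Uh.
  by rewrite mul0mx.
- by move=> h; rewrite /U T0 PQ.
- by move=> a b h h'; rewrite /U T_bracket mulmxBl -!scalemxAl !dot_mulmxr.
have dotT a h b : dot (T a h) (b *m G) = c a * dot h b.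
  by rewrite dot_mulmxr -/Q -/(U a h) Uc dotZl.
(* Integral invertibility comes from surjectivity of [phi]: an exponent not of the form [a *m G]
   would occur in no image. *)
have Gu : G \in unitmx.
  apply: unitmx_of_surj => k.
  pose h0 : 'rV[K]_n := delta_mx 0 (Ordinal n_gt0).
  have [d dd phid] := lie_aut_surj (dW k h0).
  have := dcoef_W B k h0 k; rewrite eqxx -phid lie_aut_expand // dcoef_sum => sumE.
  have /hasP[a _ /eqP<-] : has (fun a => a *m G == k) (dsupp d); last by exists a.
  apply: contraT => /hasPn none; have : h0 = 0.
    rewrite -sumE big1_seq // => a /= /none ak.
    by rewrite phiW dcoef_W eq_sym (negPf ak).
  by move=> /rowP/(_ (Ordinal n_gt0))/eqP; rewrite !mxE !eqxx oner_eq0.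
have sa := laut_alg_aut B cc Gu; exists (laut B G c); split=> // d dd.
have ls := laut_linear B G c.
have main a h f : phi (W a h) (laut B G c f) = laut B G c (W a h f).
  have [lp _] := dphi a h; have [lW _] := dW a h.
  apply: (linear_map_eq (B := B) (s := phi (W a h) \o laut B G c)
                        (t := laut B G c \o W a h)).
  - exact: linear_map_comp.
  - exact: linear_map_comp.
  move=> b /=; rewrite W_mon !lautU !linear_mapZ // phiW W_mon lautU dotT.
  by rewrite !scalerA mulmxDl cc.1; congr (_ *: _); ring.
move=> f; rewrite lie_aut_expand // [in RHS](derivation_expand B dd) linear_map_sum //.
by apply: eq_bigr => a _; rewrite main.
Qed.

(** If [s] and [s'] both induce [phi], the inverse of [s] composed with [s'] commutes with every
    derivation, so [commuting_id] applies. *)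
Lemma lie_aut_conj_unique : exists! s, is_alg_aut s /\
  forall d, is_derivation d -> forall f, phi d (s f) = s (d f).
Proof.
have [s [sa sphi]] := lie_aut_conj; exists s; split=> // s' [[ls' s'M s'1 _] s'phi].
have [ls sM s1 [t st ts]] := sa; have [lt tM t1 _] := alg_aut_inv sa st ts.
apply: functional_extensionality => f; apply: (can_inj ts).
rewrite st; apply/esym.
apply: (@commuting_id char0 (t \o s')) => [||d dd g] /=.
- exact: linear_map_comp.
- by rewrite s'1.
by rewrite -s'phi // -{1}[s' g]ts sphi // st.
Qed.

End OneAutomorphism.
End LieAutomorphisms.

(** * The Laurent polynomial algebra as an instance *)

Section LaurentBasis.
Context (K : fieldType) (n : nat).
Local Notation L := (laurent K n).

Lemma xmonD (a b : expo n) : xmon (a + b) = xmon a * xmon b :> L.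
Proof. by rewrite [RHS]lmulUU mulr1. Qed.

Lemma mcoeff_linear k (c : K) (f g : L) : (c *: f + g)@_k = c * f@_k + g@_k.
Proof. by rewrite mcoeffD; congr (_ + _); apply: mcoeffZ. Qed.

Lemma laurentE (f : L) : f = \sum_(k <- msupp f) f@_k *: xmon k.
Proof.
rewrite {1}[f]monalgE; apply: eq_bigr => k _; apply/malgP => a.
rewrite [RHS](mcoeffZ f@_k (xmon k) a) [in RHS](mcoeffU k 1 a).
by rewrite (mcoeffU k (f@_k) a) mulr_natr.
Qed.

(** Transparent, so that [mon (laurent_basis K n)] converts to [xmon]. *)
Definition laurent_basis : monomial_basis n (L : comAlgType K).
Proof.
apply: (@MonomialBasis K n L (@xmon K n) (fun k => mcoeff k)
                             (fun f => enum_fset (msupp f))).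
- by [].
- exact: xmonD.
- exact: mcoeff_linear.
- by move=> a k; apply: mcoeffU.
- by move=> f k; symmetry; apply: mcoeff_neq0.
- by move=> f; apply: fset_uniq.
- exact: laurentE.
Defined.

Lemma alg_autE (s : L -> L) : alg_aut s = is_alg_aut (L := L : comAlgType K) s.
Proof. reflexivity. Qed.

Lemma derivationE : @derivation K n = @is_derivation K (L : comAlgType K).
Proof. reflexivity. Qed.

Lemma lie_autE phi : @lie_aut K n phi = @is_lie_aut K (L : comAlgType K) phi.
Proof. reflexivity. Qed.

End LaurentBasis.

Theorem theorem1p1 (K : fieldType) (n : nat) :
  [pchar K] =i pred0 -> (0 < n)%N ->
  (* 1. sigma |-> (d |-> sigma d sigma^{-1}) is a well-defined map
        Aut_{K-alg}(L_n) -> Aut_Lie(W_n) *)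
  (forall s : laurent K n -> laurent K n, alg_aut s ->
     exists phi, lie_aut phi /\
       forall d, derivation d -> forall f, phi d (s f) = s (d f)) /\
  (* 2. it is bijective: every Lie automorphism phi of W_n is
        d |-> sigma d sigma^{-1} for a unique K-algebra automorphism sigma *)
  (forall phi, lie_aut phi ->
     exists! s : laurent K n -> laurent K n, alg_aut s /\
       forall d, derivation d -> forall f, phi d (s f) = s (d f)) /\
  (* 3. Aut_{K-alg}(L_n) ~ GL_n(Z) x| K^{*n}:
        (a) for A in GL_n(Z), lam in K^{*n}, x_i |-> lam_i prod_j x_j^{a_ji}
            extends to a K-algebra automorphism, *)
  (forall (A : 'M[int]_n) (lam : 'rV[K]_n), A \in unitmx ->
     (forall i, lam 0 i != 0) ->
     exists s, alg_aut s /\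
       forall i, s (xvar i) = lam 0 i *: xmon (\row_j A j i)) /\
  (*    (b) every K-algebra automorphism is of this form for a unique
            pair (A, lam), *)
  (forall s, alg_aut s ->
     exists! p : 'M[int]_n * 'rV[K]_n,
       [/\ p.1 \in unitmx, (forall i, p.2 0 i != 0) &
           forall i, s (xvar i) = p.2 0 i *: xmon (\row_j p.1 j i)]) /\
  (*    (c) with the semidirect product law
            (A, lam) (B, mu) = (A B, (mu_i prod_j lam_j^{b_ji})_i). *)
  (forall (s t : laurent K n -> laurent K n) (A B : 'M[int]_n)
          (lam mu : 'rV[K]_n),
     alg_aut s -> alg_aut t ->
     (forall i, s (xvar i) = lam 0 i *: xmon (\row_j A j i)) ->
     (forall i, t (xvar i) = mu 0 i *: xmon (\row_j B j i)) ->
     forall i, s (t (xvar i)) =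
       (mu 0 i * \prod_j lam 0 j ^ B j i) *: xmon (\row_j (A *m B) j i)).
Proof.
move=> char0 n_gt0; split; [|split; [|split; [|split]]].
- by move=> s; rewrite alg_autE derivationE; apply: alg_aut_lie_aut.
- move=> phi; rewrite lie_autE derivationE.
  exact: (lie_aut_conj_unique (laurent_basis K n) char0 n_gt0).
- exact: (laut_exists (laurent_basis K n)).
- exact: (alg_aut_matrix (laurent_basis K n)).
move=> s t A M lam mu sa ta sE tE.
exact: (@alg_aut_comp K n _ (laurent_basis K n) s t A M lam mu sa ta sE tE).
Qed.
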